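(* Let $G$ be a bridgeless planar ribbon graph with planar dual ribbon graph $G^\star$. Let $\beta$ and $\beta^\star$ denote the canonical Bernardi actions of $\operatorname{Pic}^0(G)$ on $S(G)$ and of $\operatorname{Pic}^0(G^\star)$ on $S(G^\star)$, respectively. Then for all $\gamma \in \operatorname{Pic}^0(G)$ and $T \in S(G)$, \[ \sigma(\beta(\gamma, T)) = \beta^\star(\Psi(\gamma), \sigma(T)), \] i.e. the diagram with rows $\beta : \operatorname{Pic}^0(G) \times S(G) \to S(G)$ and $\beta^\star : \operatorname{Pic}^0(G^\star)\times S(G^\star) \to S(G^\star)$ and vertical maps $\Psi \times \sigma$ and $\sigma$ commutes.
   Context: A graph means a finite connected multigraph without loop edges; a ribbon graph is a graph with a cyclic ordering of the edges around each vertex. $G$ is a planar ribbon graph if it is embedded in $\mathbb{R}^2$ without crossings with cyclic orderings induced by the counterclockwise orientation. A bridge is an edge whose removal disconnects the graph. The planar dual $G^\star$ has a vertex for each face of the embedding and an edge $e^\star$ crossing each edge $e$ of $G$; its ribbon structure is the one induced by the opposite (clockwise) orientation of the plane. $S(G)$ is the set of spanning trees; $\sigma : S(G) \to S(G^\star)$ sends $T$ to the spanning tree whose edges are the duals of the edges of $G$ not in $T$. Divisors, $\Delta f = \sum_u \big(\sum_{\text{edges } uw}(f(u)-f(w))\big)(u)$, linear equivalence ($D\sim D'$ iff $D-D'=\Delta f$), and $\operatorname{Pic}^d$ (classes of degree-$d$ divisors) are as usual; $\operatorname{Pic}^0$ is a group. Directed edges of $G$ are identified with directed edges of $G^\star$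 by orienting $e^\star$ from the orientation of $e$ by following the orientation of the plane locally at the crossing; this gives an isomorphism $c \mapsto c^\star$ between integral $1$-chains on $G$ and on $G^\star$. With $\partial$ the boundary map from $1$-chains to degree-$0$ divisors (a directed edge $(x,y)$ maps to $(y)-(x)$), every class in $\operatorname{Pic}^0(G)$ is $[\partial c]$ for some integral $1$-chain $c$, and $\Psi : \operatorname{Pic}^0(G) \to \operatorname{Pic}^0(G^\star)$, $[\partial c] \mapsto [\partial c^\star]$, is a well-defined isomorphism. Genus $g = |E|-|V|+1$. For a spanning tree $T$ with non-tree edges $e_1,\dots,e_g$, a $T$-break divisor is $\sum_i(v_i)$ with $v_i$ an endpoint of $e_i$; $B(G)$ is the set of all such. Every class of $\operatorname{Pic}^g(G)$ contains a unique element of $B(G)$; $\gamma \cdot D :=$ the break divisor linearly equivalent to $D+\gamma$. Bernardi map: for a vertex $v$, an edge $e$ at $v$, and a spanning tree $T$, the tour starts at $v$ examining edges at $v$ in cyclic order starting with $e$; at current vertex $u$, an examined edge $f\notin T$ is cut through from $u$ and the next edge at $u$ examined, while $f \in T$ is walked along to its other endpoint $u'$, then edges at $u'$ are examined starting with the one after $f$; the tour ends when each tree edge is traversed in both directions. $\eta_{(v,e)}(f)$ is the endpoint from which $f\notin T$ is first cut through, and $\beta_{(v,e)}(T)=\sum_{f\notin T}(\eta_{(v,e)}(f))$, a bijection $S(G)\to B(G)$. The action $\beta_v$ is $\gamma\cdot T := \beta_{(v,e)}^{-1}(\gamma\cdot\beta_{(v,e)}(T))$; for planar ribbon graphs it is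 independent of $v$ and $e$, and this common action is $\beta$ (similarly $\beta^\star$ for $G^\star$). *)

(* Defs.v *)
From HB Require Import structures.
From mathcomp Require Import all_boot all_order all_fingroup all_algebra.
From Stdlib Require Import ClassicalEpsilon.
Set Implicit Arguments. Unset Strict Implicit. Unset Printing Implicit Defensive.
Import GRing.Theory Num.Theory.
Local Open Scope ring_scope.

(* A ribbon graph is encoded as a combinatorial map on a finite set of darts
   (half-edges) D:  alpha : {perm D}  is the edge involution (a dart and its
   reverse), rho : {perm D} is the rotation: rho d is the next dart, in the
   cyclic ordering, around the vertex at which d starts.  Vertices are the
   rho-orbits, edges the alpha-orbits.  A dart d is read as the directed edge
   from vtx d to vtx (alpha d). *)

Section RibbonGraph.
Variables (D : finType) (alpha rho : {perm D}).

Definition Vx : Type := {x : D | froots rho x}.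

Lemma froots_froot (d : D) : froots rho (froot rho d).
Proof. apply: roots_root; apply: fconnect_sym; exact: perm_inj. Qed.

Definition vtx (d : D) : Vx := exist _ (froot rho d) (froots_froot d).

Definition divisor := {ffun Vx -> int}.

Definition bnd (c : D -> int) : divisor :=
  [ffun u => \sum_(d : D) c d * (((vtx (alpha d) == u) : int) - ((vtx d == u) : int))].

(* Laplacian: (Delta f)(u) = sum over edges uw at u of f(u) - f(w);
   the edges at u are the darts starting at u (no loops). *)
Definition laplacian (f : Vx -> int) (u : Vx) : int :=
  \sum_(d | vtx d == u) (f u - f (vtx (alpha d))).

Definition lin_equiv (D1 D2 : divisor) : Prop :=
  exists f : Vx -> int, forall u, D1 u - D2 u = laplacian f u.

Definition conn_in (S : {set D}) (x y : Vx) : bool :=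
  connect (fun a b : Vx => [exists d in S, (vtx d == a) && (vtx (alpha d) == b)]) x y.

(* spanning trees, as alpha-closed sets of darts: the subgraph is connected,
   spans all vertices, and is acyclic (every edge of it is a bridge of it) *)
Definition spanning_tree (T : {set D}) : Prop :=
  [/\ forall d, (d \in T) = (alpha d \in T),
      forall x y : Vx, conn_in T x y &
      forall d, d \in T -> ~~ conn_in (T :\ d :\ alpha d) (vtx d) (vtx (alpha d))].

(* Bernardi tour with respect to T, starting with the dart d0
   (i.e. at vertex v = vtx d0, beginning with the edge e of d0):
   an examined dart d not in T is cut through and the next dart rho d at the
   same vertex is examined; a dart d in T is walked along to the other end
   and the dart following alpha d there, rho (alpha d), is examined. *)
Definition tour_step (T : {set D}) (d : D) : D :=
  if d \in T then rho (alpha d) else rho d.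

Definition tour (T : {set D}) (d0 : D) : seq D :=
  [seq iter k (tour_step T) d0 | k <- iota 0 #|D|].

(* Bernardi break divisor: each non-tree edge contributes the endpoint from
   which it is first cut through in the tour *)
Definition bernardi (d0 : D) (T : {set D}) : divisor :=
  let s := tour T d0 in
  [ffun u => \sum_(d | [&& d \notin T, vtx d == u & (index d s < index (alpha d) s)%N]) 1].

(* break divisors: for a spanning tree T, pick one endpoint of each non-tree
   edge (a set P containing exactly one dart of each non-tree edge) *)
Definition is_break (B : divisor) : Prop :=
  exists T : {set D}, spanning_tree T /\
  exists P : {set D},
    [/\ forall d, d \in P -> d \notin T,
        forall d, d \notin T -> (d \in P) != (alpha d \in P) &
        B = [ffun u => \sum_(d in P | vtx d == u) 1]].

(* gamma . B := the break divisor linearly equivalent to B + gamma, where the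
   class gamma in Pic^0 is given as [bnd c] *)
Definition break_act (c : D -> int) (B : divisor) : divisor :=
  epsilon (inhabits B)
    (fun B' => is_break B' /\ lin_equiv B' [ffun u => B u + bnd c u]).

(* Bernardi action beta_{(v,e)} (v,e encoded by the dart d0):
   gamma . T := beta^{-1}(gamma . beta(T)) *)
Definition bernardi_act (d0 : D) (c : D -> int) (T : {set D}) : {set D} :=
  epsilon (inhabits T)
    (fun T' => spanning_tree T' /\ bernardi d0 T' = break_act c (bernardi d0 T)).

End RibbonGraph.

Arguments Vx [D] rho.
Arguments vtx [D] rho d.
Arguments divisor [D] rho.
Arguments bnd [D] alpha rho c.
Arguments laplacian [D] alpha rho f u.
Arguments lin_equiv [D] alpha rho D1 D2.
Arguments conn_in [D] alpha rho S x y.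
Arguments spanning_tree [D] alpha rho T.
Arguments tour_step [D] alpha rho T d.
Arguments tour [D] alpha rho T d0.
Arguments bernardi [D] alpha rho d0 T.
Arguments is_break [D] alpha rho B.
Arguments break_act [D] alpha rho c B.
Arguments bernardi_act [D] alpha rho d0 c T.

(* The planar dual of (D, alpha, sigma).  Dual darts are encoded by the same
   type D: the dual dart x runs from the face on the right of the primal dart x
   to the face on its left (faces = orbits of sigma o alpha; the face on the
   right of d is the one containing d).  The dual has the same edge involution
   alpha and rotation sigma o alpha, which is the clockwise successor of the
   dual edges around each face.  In mathcomp, (alpha * sigma)%g x = sigma (alpha x). *)
Definition dual_rot (D : finType) (alpha sigma : {perm D}) : {perm D} :=
  (alpha * sigma)%g.

(* The chain isomorphism c |-> c^star: the directed primal edge d (from x to y)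
   is sent to the directed dual edge crossing it whose orientation goes from
   the face on the LEFT of d to the face on its RIGHT; in the encoding above
   that dual dart is alpha d.  Hence (c^star)(x) = c(alpha x). *)
Definition dual_chain (D : finType) (alpha : {perm D}) (c : D -> int) : D -> int :=
  fun x => c (alpha x).

Definition ribbon_graph (D : finType) (alpha sigma : {perm D}) : Prop :=
  [/\ forall d, alpha (alpha d) = d,
      forall d, alpha d != d,
      forall d, vtx sigma (alpha d) != vtx sigma d &
      forall x y : Vx sigma, conn_in alpha sigma [set: D] x y].

(* genus 0:  #V - #E + #F = 2, with #E = #D/2 and faces = orbits of sigma o alpha *)
Definition planar (D : finType) (alpha sigma : {perm D}) : Prop :=
  (#|{: Vx sigma}| + #|{: Vx (dual_rot alpha sigma)}| = #|D| %/ 2 + 2)%N.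

Definition bridgeless (D : finType) (alpha sigma : {perm D}) : Prop :=
  forall d, conn_in alpha sigma (~: [set d; alpha d]) (vtx sigma d) (vtx sigma (alpha d)).

(* Main.v *)
(* Read from the same dart, the tour of the complementary tree in the dual is the
   tour of T itself.  Let O(T, d0) be the orientation in which tree edges point
   to the root and each other edge leaves the end from which it is first cut:
   then beta(T) is its out-degree divisor minus (v) for each v other than the
   root, and O of the dual tree is the reverse of O(T, d0).  In a planar graph a
   chain whose boundary is principal is a sum of a cut and a cycle, and duality
   exchanges these; so "beta(T') ~ beta(T) + bnd c" is the self-dual condition
   that O(T', d0) - O(T, d0) + c is a sum of cuts and cycles.
   That such a T' exists: Minty's lemma turns O(T, d0) - c into an orientation,
   reversals of directed cuts and cycles make every vertex reach the root and
   every face reach the face of d0 in the dual, and such an orientation is some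
   O(T', d0), by successive tree exchanges along the tour.  Reachability also
   gives uniqueness of break divisors and injectivity of beta.  Finally, moving
   d0 around its vertex changes all beta(T) by the same class, and duality gives
   the moves around a face, hence independence of the base darts. *)
Require Import Defs.
From mathcomp Require Import all_boot all_order all_fingroup all_algebra.
From mathcomp Require Import zify ring.
From Stdlib Require Import ClassicalEpsilon.
Set Implicit Arguments. Unset Strict Implicit. Unset Printing Implicit Defensive.
Import Order.TTheory GRing.Theory Num.Theory.
Local Open Scope ring_scope.

(** Since [al] is an involution the relation is symmetric in [rho] and [phi], so each lemma proved
    from it also holds in the dual. *)
Definition dual_maps (D : finType) (al rho phi : {perm D}) : Prop :=
  [/\ involutive al, forall d, al d != d & forall d, phi d = rho (al d)].

Lemma dual_maps_sym (D : finType) (al rho phi : {perm D}) :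
  dual_maps al rho phi -> dual_maps al phi rho.
Proof. by case=> alK al_neq phiE; split=> // d; rewrite phiE alK. Qed.

(** * Vertices and connectivity *)

Section Vertices.
Variables (D : finType) (al rho : {perm D}).

Lemma vtx_eq x y : (vtx rho x == vtx rho y) = fconnect rho x y.
Proof.
rewrite -(root_connect (fconnect_sym (@perm_inj _ rho))).
by apply/eqP/eqP => [[]|e] //; apply: val_inj.
Qed.

Lemma vtx_rot d : vtx rho (rho d) = vtx rho d.
Proof.
by apply/eqP; rewrite vtx_eq fconnect_sym ?fconnect1 //; apply: perm_inj.
Qed.

Lemma vtx_onto u : exists d, vtx rho d = u.
Proof. by case: u => x xr; exists x; apply: val_inj; apply/eqP. Qed.

Lemma vtx_inv (A : D -> Prop) : (forall d, A d -> A (rho d)) ->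
  forall x y, vtx rho x = vtx rho y -> A x -> A y.
Proof.
move=> Ar x y /eqP; rewrite vtx_eq => /iter_findex <-.
by move=> Ax; elim: (findex _ _ _) => //= n; apply: Ar.
Qed.

Lemma vtx_inv_eq (W : Type) (A : D -> W) : (forall d, A (rho d) = A d) ->
  forall x y, vtx rho x = vtx rho y -> A x = A y.
Proof.
by move=> Ar x y /vtx_inv e; apply: (e (fun z => A x = A z)) => // d; rewrite Ar.
Qed.

Lemma conn_edge (S : {set D}) d : d \in S ->
  conn_in al rho S (vtx rho d) (vtx rho (al d)).
Proof. by move=> dS; apply: connect1; apply/existsP; exists d; rewrite dS !eqxx. Qed.

Lemma conn_trans (S : {set D}) : transitive (conn_in al rho S).
Proof. exact: connect_trans. Qed.

Lemma conn_refl (S : {set D}) x : conn_in al rho S x x.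
Proof. exact: connect0. Qed.

Lemma conn_closed (S : {set D}) (A : Vx rho -> Prop) x y :
  (forall d, d \in S -> A (vtx rho d) -> A (vtx rho (al d))) ->
  conn_in al rho S x y -> A x -> A y.
Proof.
move=> AS /connectP[p pp ->] {y}.
elim: p x pp => //= z p IHp x /andP[/existsP[d /and3P[dS /eqP dx /eqP dz]] pp] Ax.
by apply: IHp => //; rewrite -dz; apply: AS; rewrite ?dx.
Qed.

Lemma conn_sub (S S' : {set D}) x y : {subset S <= S'} ->
  conn_in al rho S x y -> conn_in al rho S' x y.
Proof.
move=> sS c; apply: (conn_closed (A := conn_in al rho S' x) _ c) (conn_refl _ _).
by move=> d dS xd; apply: conn_trans xd _; apply/conn_edge/sS.
Qed.

Lemma conn_sym (S : {set D}) x y : involutive al ->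
  (forall d, d \in S -> al d \in S) ->
  conn_in al rho S x y -> conn_in al rho S y x.
Proof.
move=> alK aS c.
apply: (conn_closed (A := fun z => conn_in al rho S z x) _ c) (conn_refl _ _).
move=> d dS xd; apply: conn_trans xd.
by rewrite -{2}(alK d); apply/conn_edge/aS.
Qed.

Lemma conn_first (S : {set D}) x y : conn_in al rho S x y -> x != y ->
  exists2 d, d \in S & vtx rho d = x /\ conn_in al rho S (vtx rho (al d)) y.
Proof.
case/connectP=> -[|z p] /=; first by move=> _ ->; rewrite eqxx.
case/andP=> /existsP[d /and3P[dS /eqP <- /eqP <-]] pp -> _.
by exists d => //; split=> //; apply/connectP; exists p.
Qed.

End Vertices.

(** * The tour and its orientation *)

Section Tour.
Variables (D : finType) (al rho phi : {perm D}).
Hypothesis maps : dual_maps al rho phi.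

Let alK : involutive al. Proof. by case: maps. Qed.
Let al_neq d : al d != d. Proof. by case: maps. Qed.
Let phiE d : phi d = rho (al d). Proof. by case: maps. Qed.

(** A tree seen as an edge set whose tour is a single cycle through all darts. On the sphere this is
    equivalent to [spanning_tree], and it passes directly to the complement in the dual. *)
Definition unicellular (T : {set D}) : Prop :=
  (forall d, (al d \in T) = (d \in T)) /\
  forall x y, fconnect (tour_step al rho T) x y.

Definition pos (T : {set D}) (d0 d : D) : nat := index d (tour al rho T d0).

(** Walking along an edge is cutting through its dual edge, and conversely; with the complementary
    set both rules choose the same next dart. *)
Lemma tour_step_dual (T : {set D}) : tour_step al phi (~: T) =1 tour_step al rho T.
Proof. by move=> d; rewrite /tour_step inE if_neg !phiE alK. Qed.

Lemma vtx_step_in (T : {set D}) d : d \in T ->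
  vtx rho (tour_step al rho T d) = vtx rho (al d).
Proof. by rewrite /tour_step => ->; rewrite vtx_rot. Qed.

Lemma vtx_step_notin (T : {set D}) d : d \notin T ->
  vtx rho (tour_step al rho T d) = vtx rho d.
Proof. by rewrite /tour_step => /negPf->; rewrite vtx_rot. Qed.

Lemma tour_step_inj (T : {set D}) : (forall d, (al d \in T) = (d \in T)) ->
  injective (tour_step al rho T).
Proof.
move=> aT x y; rewrite /tour_step.
case: ifP => xT; case: ifP => yT /perm_inj //; first by move/perm_inj.
- by move=> e; rewrite -e aT xT in yT.
- by move=> e; rewrite e aT yT in xT.
Qed.

Section Unicellular.
Variable T : {set D}.
Hypothesis uT : unicellular T.
Notation f := (tour_step al rho T).

Lemma order_unicellular d0 : fingraph.order f d0 = #|D|.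
Proof. by apply: eq_card => d; rewrite inE; case: uT => _ ->. Qed.

Lemma tourE d0 : tour al rho T d0 = fingraph.orbit f d0.
Proof.
rewrite /tour /fingraph.orbit order_unicellular.
apply: (@eq_from_nth _ d0); rewrite ?size_map ?size_iota ?size_traject // => i ilt.
by rewrite (nth_map 0%N) ?size_iota // nth_iota // nth_traject.
Qed.

Lemma posE d0 d : pos T d0 d = findex f d0 d.
Proof. by rewrite /pos tourE. Qed.

Lemma pos_lt d0 d : (pos T d0 d < #|D|)%N.
Proof. by rewrite posE -(order_unicellular d0) findex_max //; case: uT. Qed.

Lemma pos_iter d0 i : (i < #|D|)%N -> pos T d0 (iter i f d0) = i.
Proof. by move=> ilt; rewrite posE findex_iter // order_unicellular. Qed.

Lemma iter_pos d0 d : iter (pos T d0 d) f d0 = d.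
Proof. by rewrite posE iter_findex //; case: uT. Qed.

Lemma pos_inj d0 : injective (pos T d0).
Proof. by move=> x y e; rewrite -(iter_pos d0 x) e iter_pos. Qed.

Lemma pos0 d0 : pos T d0 d0 = 0%N.
Proof. by rewrite posE findex0. Qed.

Lemma pos_eq0 d0 d : (pos T d0 d == 0%N) = (d == d0).
Proof. by rewrite posE findex_eq0 eq_sym. Qed.

Lemma pos_al d0 d : (pos T d0 (al d) < pos T d0 d)%N = ~~ (pos T d0 d < pos T d0 (al d))%N.
Proof.
rewrite -leqNgt ltn_neqAle; case: eqP => //= /pos_inj e.
by move: (al_neq d); rewrite e eqxx.
Qed.

End Unicellular.
End Tour.

(** * Spanning trees and their single tour *)

Section Trees.
Variables (D : finType) (al rho phi : {perm D}).
Hypothesis maps : dual_maps al rho phi.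

Let alK : involutive al. Proof. by case: maps. Qed.

Definition orientation (O : {set D}) : Prop := forall d, (al d \in O) = (d \notin O).

(* The edge of d is counted at the tail vtx d, so a non-tree dart of orient T d0
   sits at the vertex from which its edge is first cut through. *)
Definition orient (T : {set D}) (d0 : D) : {set D} :=
  [set d | (d \in T) (+) (pos al rho T d0 d < pos al rho T d0 (al d))%N].

Lemma card_half (S O : {set D}) : (forall d, (al d \in S) = (d \in S)) ->
  orientation O -> #|S| = (#|S :&: O|).*2.
Proof.
move=> aS aO; rewrite -addnn -(cardsID O S); congr addn.
rewrite -(card_imset (mem (S :&: O)) (@perm_inj _ al)); apply: eq_card => d.
apply/setDP/imsetP => [[dS dO]|[x + ->]].
  by exists (al d); rewrite ?alK // !inE aS aO dS.
by rewrite inE aO aS negbK => /andP[].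
Qed.

Lemma closed_delete (T : {set D}) d : (forall x, (al x \in T) = (x \in T)) ->
  forall x, x \in T :\ d :\ al d -> al x \in T :\ d :\ al d.
Proof.
move=> aT x; rewrite !inE aT !(can2_eq alK alK) alK.
by rewrite andbCA.
Qed.

(** The tour changes vertex only by walking along a dart of [T]; while it avoids [d] and [al d] it
    stays in one component of [T] without that edge. *)
Lemma conn_tour (T : {set D}) d x n :
  (forall i, (i < n)%N -> iter i (tour_step al rho T) x \notin [set d; al d]) ->
  conn_in al rho (T :\ d :\ al d) (vtx rho x) (vtx rho (iter n (tour_step al rho T) x)).
Proof.
elim: n => [|n IHn] ne; first exact: conn_refl.
apply: conn_trans (IHn _) _ => [i ilt|]; first by apply: ne; rewrite ltnS ltnW.
rewrite iterS; set y := iter n _ x.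
have [yT|yT] := boolP (y \in T); last by rewrite vtx_step_notin ?conn_refl.
rewrite vtx_step_in //; apply: conn_edge.
by have := ne n (ltnSn n); rewrite !inE negb_or yT => /andP[-> ->].
Qed.

Lemma spanning_tree_unicellular (T : {set D}) :
  spanning_tree al rho T -> unicellular al rho T.
Proof.
case=> aT cT acT; have aT' d : (al d \in T) = (d \in T) by rewrite [in RHS]aT.
split=> // d0 y.
set f := tour_step al rho T; have f_inj : injective f by exact: tour_step_inj.
(* If the orbit of [d0] contained [d] but not [al d], the tour from the far end of [d] would come
   back to [d] without using this edge, which is a bridge of [T]. *)
have Xal d : d \in T -> fconnect f d0 d -> fconnect f d0 (al d).
  move=> dT Xd; apply: contraT => nX.
  have cfd : fconnect f (f d) d by rewrite fconnect_sym // fconnect1.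
  have := acT _ dT; case/negP; apply: conn_sym => //; first exact: closed_delete.
  rewrite -[X in conn_in _ _ _ _ (vtx _ X)](iter_findex cfd) -(vtx_step_in al rho dT).
  apply: conn_tour => i ilt; rewrite !inE negb_or; apply/andP; split.
    apply/eqP => e; have := findex_iter (f := f) (x := f d) (i := i).
    rewrite e => /(_ (ltn_trans ilt (findex_max cfd))) e2.
    by rewrite e2 ltnn in ilt.
  apply: contra nX => /eqP <-; apply: connect_trans Xd _.
  by rewrite -iterSr fconnect_iter.
(* For a tree dart, [rho d] is examined right after [al d]. Hence the orbit fills whole vertices,
   and connectivity of [T] spreads it to all darts. *)
have Xrho d : fconnect f d0 d -> fconnect f d0 (rho d).
  move=> Xd; have [dT|dT] := boolP (d \in T).
    apply: connect_trans (Xal _ dT Xd) _; apply: connect1.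
    by rewrite /= /f /tour_step aT' dT alK.
  by apply: connect_trans Xd _; apply: connect1; rewrite /= /f /tour_step (negPf dT).
pose A u := forall d, vtx rho d = u -> fconnect f d0 d.
apply: (conn_closed (A := A) _ (cT (vtx rho d0) (vtx rho y))) => // [d dT Ad x e|x e].
  by apply: (vtx_inv Xrho (esym e)); apply: Xal => //; apply: Ad.
by apply: (vtx_inv Xrho (esym e)); apply: connect0.
Qed.

Section Unicellular.
Variable T : {set D}.
Hypothesis uT : unicellular al rho T.

Let aT d : (al d \in T) = (d \in T). Proof. by case: uT. Qed.

Lemma orient_orientation d0 : orientation (orient T d0).
Proof.
move=> d; rewrite !inE aT alK (pos_al maps uT).
by case: (d \in T); case: ltnP.
Qed.

(** Induction on the position of [d]: when an edge is first walked, its reverse dart belongs to the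
    orientation and leads back to an earlier vertex; when it is walked again, the reverse dart was
    examined earlier at the same vertex. *)
Lemma orient_reach d0 u :
  conn_in al rho (T :&: orient T d0) u (vtx rho d0).
Proof.
have [d <-] := vtx_onto u.
have [n] := ubnP (pos al rho T d0 d); elim: n d => // n IHn d dlt.
case e: (pos al rho T d0 d) => [|k].
  by move/eqP: e; rewrite (pos_eq0 uT) => /eqP->; apply: conn_refl.
have klt : (k < #|D|)%N by have := pos_lt uT d0 d; lia.
set x := iter k (tour_step al rho T) d0.
have px : pos al rho T d0 x = k by rewrite (pos_iter uT).
have dx : d = tour_step al rho T x by rewrite -iterS -e (iter_pos uT).
have [xT|xT] := boolP (x \in T); last first.
  by rewrite dx vtx_step_notin //; apply: IHn; lia.
rewrite dx vtx_step_in //.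
have [lt|le] := boolP (k < pos al rho T d0 (al x))%N.
  apply: conn_trans (IHn x _); last by lia.
  rewrite -{2}(alK x); apply: conn_edge.
  by rewrite !inE aT xT alK px ltnNge (ltnW lt).
by apply: IHn; move: le dlt; rewrite e -leqNgt; lia.
Qed.

Lemma unicellular_conn x y : conn_in al rho T x y.
Proof.
have [d <-] := vtx_onto y; apply: conn_sub (orient_reach d x) => z.
by rewrite inE => /andP[].
Qed.

Lemma card_vtx_le d0 : (#|{: Vx rho}| <= #|T :&: orient T d0|.+1)%N.
Proof.
suff: (#|{: Vx rho}|.-1 <= #|T :&: orient T d0|)%N by lia.
rewrite -(cardsC1 (vtx rho d0)).
apply: leq_trans (leq_imset_card (vtx rho) (mem (T :&: orient T d0))).
apply/subset_leq_card/subsetP => u; rewrite !inE => une.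
have [d dTO [<- _]] := conn_first (orient_reach d0 u) une.
exact: imset_f.
Qed.

End Unicellular.
End Trees.

Lemma unicellular_dual (D : finType) (al rho phi : {perm D}) (T : {set D}) :
  dual_maps al rho phi -> unicellular al rho T -> unicellular al phi (~: T).
Proof.
move=> maps [aT cT]; split=> [d|x y]; first by rewrite !inE aT.
by rewrite (eq_fconnect (tour_step_dual maps T)) cT.
Qed.

Lemma orient_dual (D : finType) (al rho phi : {perm D}) (T : {set D}) d0 :
  dual_maps al rho phi -> orient al phi (~: T) d0 = ~: orient al rho T d0.
Proof.
move=> maps; apply/setP => d; rewrite !inE addNb /pos.
suff -> : tour al phi (~: T) d0 = tour al rho T d0 by [].
by apply: eq_map => k; apply: eq_iter; exact: (tour_step_dual maps).
Qed.

(** * Euler's formula and parent darts *)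

Definition spherical (D : finType) (rho phi : {perm D}) : Prop :=
  (#|{: Vx rho}| + #|{: Vx phi}| = #|D| %/ 2 + 2)%N.

Section Spherical.
Variables (D : finType) (al rho phi : {perm D}).
Hypothesis maps : dual_maps al rho phi.
Hypothesis sphere : spherical rho phi.

Let alK : involutive al. Proof. by case: maps. Qed.
Let maps' : dual_maps al phi rho. Proof. exact: dual_maps_sym. Qed.

Section Unicellular.
Variable T : {set D}.
Hypothesis uT : unicellular al rho T.
Variable d0 : D.
Notation O := (orient al rho T d0).

Let aT d : (al d \in T) = (d \in T). Proof. by case: uT. Qed.

(** [card_vtx_le] bounds the vertices by one plus half the darts of [T] and, in the dual, the faces
    by one plus half the other darts. The sum of the bounds is Euler's formula, so both are
    equalities. *)
Lemma card_vtx : #|{: Vx rho}| = #|T :&: O|.+1.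
Proof.
have uT' := unicellular_dual maps uT.
have oO := orient_orientation maps uT d0.
have := card_vtx_le maps uT d0; have := card_vtx_le maps' uT' d0.
rewrite (orient_dual _ _ maps).
have aD d : (al d \in [set: D]) = (d \in [set: D]) by rewrite !inE.
have cD := card_half maps aD oO.
have oO' : orientation al (~: O) by move=> d; rewrite !in_setC oO.
have aT' d : (al d \in ~: T) = (d \in ~: T) by rewrite !inE aT.
have := card_half maps aT' oO; rewrite (card_half maps aT' oO') => /double_inj ->.
move: cD sphere; rewrite /spherical setTI cardsT => ->; rewrite -muln2 mulnK //.
by have := cardsID T O; rewrite setDE (setIC O T) (setIC O); lia.
Qed.

(** Each vertex other than the root has an outgoing dart in [T :&: O], since it reaches the root.
    There are #V - 1 such darts, so each of these vertices has exactly one, its parent dart, and the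
    root none. *)
Lemma card_parent u : #|[set d in T :&: O | vtx rho d == u]| = (u != vtx rho d0).
Proof.
pose c u := #|[set d in T :&: O | vtx rho d == u]|.
have cge v : ((v != vtx rho d0) <= c v)%N.
  case: eqVneq => //= vne; rewrite card_gt0; apply/set0Pn.
  have [d dTO [e _]] := conn_first (orient_reach maps uT d0 v) vne.
  by exists d; rewrite inE dTO e eqxx.
have sc : (\sum_v c v = #|T :&: O|)%N.
  rewrite -sum1_card (partition_big (vtx rho) predT) //=; apply: eq_bigr => v _.
  by rewrite sum1dep_card; apply: eq_card => d; rewrite !inE.
have sv : (\sum_v (v != vtx rho d0) = #|T :&: O|)%N.
  transitivity #|[set~ vtx rho d0]|; last by rewrite cardsC1 card_vtx.
  by rewrite -sum1_card [RHS]big_mkcond; apply: eq_bigr => v _; rewrite !inE; case: eqP.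
have [_] := leqif_sum (fun v (_ : true) => leqif_geq (cge v)).
rewrite sc sv eqxx => /esym/forallP/(_ u) /=.
by rewrite -/(c u) => le; apply/eqP; rewrite eqn_leq le cge.
Qed.

Lemma parent_vtx_inj : {in T :&: O &, injective (vtx rho)}.
Proof.
move=> x y xP yP e.
have /card_le1_eqP := leq_trans (eq_leq (card_parent (vtx rho x))) (leq_b1 _).
by apply; rewrite inE ?xP ?yP ?e eqxx.
Qed.

Lemma parent_vtx_neq d : d \in T :&: O -> vtx rho d != vtx rho d0.
Proof.
move=> dP; apply/eqP => e; have := card_parent (vtx rho d).
rewrite e eqxx => /eqP; rewrite cards_eq0 => /eqP/setP/(_ d).
by rewrite in_set dP e eqxx in_set0.
Qed.

(** The set [Z] of descendants of [vtx rho d] is closed under the tree edges other than that of [d],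
    parent darts being unique. It misses the head of [d]: otherwise the root would be a descendant,
    yet no parent dart leaves the root. *)
Lemma parent_bridge d : d \in T :&: O ->
  ~~ conn_in al rho (T :\ d :\ al d) (vtx rho d) (vtx rho (al d)).
Proof.
move=> dP; set P := T :&: O in dP *; pose Z u := conn_in al rho P u (vtx rho d).
have Zstep x : x \in P -> x != d -> Z (vtx rho x) -> Z (vtx rho (al x)).
  move=> xP xd Zx; have ne : vtx rho x != vtx rho d.
    by apply: contra xd => /eqP/parent_vtx_inj ->.
  by have [y yP [/parent_vtx_inj <-]] := conn_first Zx ne.
have nZ : ~ Z (vtx rho (al d)).
  move=> Zd; have Zq : Z (vtx rho d0).
    have c0 := orient_reach maps uT d0 (vtx rho d).
    apply: (conn_closed (A := Z) _ c0); last exact: conn_refl.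
    by move=> x xP Zx; case: (eqVneq x d) => [->|xd] //; apply: Zstep.
  have [|x xP [e _]] := conn_first Zq; first by rewrite eq_sym parent_vtx_neq.
  by have := parent_vtx_neq xP; rewrite e eqxx.
apply/negP => c; apply: nZ; apply: (conn_closed (A := Z) _ c); last exact: conn_refl.
move=> x; rewrite !in_setD1 => /and3P[xad xd xT] Zx.
have [xO|xO] := boolP (x \in O); first by apply: Zstep => //; rewrite in_setI xT.
apply: conn_trans Zx; rewrite -{2}(alK x); apply: conn_edge.
by rewrite in_setI aT xT (orient_orientation maps uT).
Qed.

(** [O'] is left free off [T] so that the count covers every choice of ends in a break divisor. *)
Lemma orient_degree (O' : {set D}) u : {in T, O' =i O} ->
  \sum_(d | vtx rho d == u) ((d \in O')%:R : int) =
  \sum_(d | [&& d \notin T, d \in O' & vtx rho d == u]) 1 + (u != vtx rho d0)%:R.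
Proof.
move=> eO; rewrite (bigID (mem T)) [RHS]addrC /=; congr (_ + _); last first.
  rewrite big_mkcond [RHS]big_mkcond; apply: eq_bigr => d _ /=.
  by case: (d \in T); case: (d \in O'); case: eqP.
rewrite -card_parent -sum1_card natr_sum big_mkcond [RHS]big_mkcond.
apply: eq_bigr => d _ /=; rewrite inE in_setI.
case: (boolP (d \in T)) => dT; rewrite ?andbF //= andbT.
by rewrite (eO _ dT); case: (vtx _ _ == _); case: (d \in O).
Qed.

Lemma bernardi_orient u : bernardi al rho d0 T u =
  \sum_(d | vtx rho d == u) ((d \in O)%:R : int) - (u != vtx rho d0)%:R.
Proof.
rewrite (orient_degree u (O' := O)) // addrK ffunE; apply: eq_bigl => d.
by rewrite inE andbCA /pos; case: (d \in T); rewrite ?andbF //= andbC.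
Qed.

End Unicellular.

Lemma unicellular_spanning_tree (T : {set D}) :
  unicellular al rho T -> spanning_tree al rho T.
Proof.
move=> uT; have aT d : (al d \in T) = (d \in T) by case: uT.
split=> [d|x y|d dT]; [by rewrite aT | exact: (unicellular_conn maps uT) |].
have [dO|dO] := boolP (d \in orient al rho T d).
  have dP : d \in T :&: orient al rho T d by rewrite in_setI dT.
  exact: (parent_bridge uT dP).
have /(parent_bridge uT) : al d \in T :&: orient al rho T d.
  by rewrite in_setI aT dT (orient_orientation maps uT).
apply: contra => c; apply: conn_sym => //; rewrite alK.
  by move=> x; rewrite !in_setD1 !(can2_eq alK alK) alK aT andbCA.
by apply: conn_sub c => x; rewrite !in_setD1 andbCA.
Qed.

End Spherical.

(** * Cuts and cycles *)

Section Flows.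
Variables (D : finType) (al rho phi : {perm D}).
Hypothesis maps : dual_maps al rho phi.

Let alK : involutive al. Proof. by case: maps. Qed.
Let phiE d : phi d = rho (al d). Proof. by case: maps. Qed.

Definition antisym (h : D -> int) : Prop := forall d, h (al d) = - h d.

(** Potentials live on darts, so that one operation gives cuts, for values constant along [rho], and
    cycles, for values constant along [phi]. *)
Definition cobound (f : D -> int) (d : D) : int := f (al d) - f d.

Definition indic (O : {set D}) (d : D) : int := (d \in O)%:R.

Lemma antisym_cobound f : antisym (cobound f).
Proof. by move=> d; rewrite /cobound alK opprB. Qed.

Lemma antisym_orientation (O1 O2 : {set D}) : orientation al O1 -> orientation al O2 ->
  antisym (fun d => indic O1 d - indic O2 d).
Proof.
move=> o1 o2 d; rewrite /indic o1 o2.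
by case: (d \in O1); case: (d \in O2).
Qed.

Lemma sum_vtx (A : pred (Vx rho)) (h : D -> int) :
  \sum_(d | A (vtx rho d)) h d = \sum_(u | A u) \sum_(d | vtx rho d == u) h d.
Proof.
rewrite (partition_big (vtx rho) A) //=; apply: eq_bigr => u Au.
by apply: eq_bigl => d; case: eqVneq => [->|]; rewrite ?Au ?andbF.
Qed.

(** The darts [d] with [d] and [al d] both in [R] cancel in pairs. *)
Lemma flux_exits (R : pred D) h : antisym h ->
  \sum_(d | R d) h d = \sum_(d | R d && ~~ R (al d)) h d.
Proof.
move=> ah; rewrite (bigID (fun d => R (al d))) /=.
set S := (X in X + _); suff -> : S = 0 by rewrite add0r.
suff: S = - S by lia.
rewrite {1}/S (reindex_inj (@perm_inj _ al)) -sumrN.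
by apply: eq_big => d; rewrite ?alK ?ah // andbC.
Qed.

(* The boundary of a face is a cycle. *)
Lemma sum_cobound_dual (g : D -> int) u : (forall d, g (phi d) = g d) ->
  \sum_(d | vtx rho d == u) cobound g d = 0.
Proof.
move=> gphi; rewrite big_split /= sumrN; apply/eqP; rewrite subr_eq0; apply/eqP.
rewrite [RHS](reindex_inj (@perm_inj _ rho)); apply: eq_big => d.
  by rewrite vtx_rot.
by rewrite -(gphi (al d)) phiE alK.
Qed.

Lemma laplacian_cobound (f : Vx rho -> int) u : laplacian al rho f u =
  \sum_(d | vtx rho d == u) - cobound (fun d => f (vtx rho d)) d.
Proof. by apply: eq_bigr => d /eqP <-; rewrite opprB. Qed.

(* On the vertices where f is maximal, every exit carries a drop of f of at
   least 1, which O1 - O2 can only match if O1 uses all exits and O2 none. *)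
Lemma laplacian_reach_const (O1 O2 : {set D}) q (f : Vx rho -> int) :
  orientation al O1 -> orientation al O2 ->
  (forall u, conn_in al rho O1 u q) -> (forall u, conn_in al rho O2 u q) ->
  (forall u, \sum_(d | vtx rho d == u) (indic O1 d - indic O2 d) = laplacian al rho f u) ->
  forall u v, f u = f v.
Proof.
move=> o1 o2 r1 r2 lapf.
have [u0 umax] : exists u0, forall u, f u <= f u0.
  by case: (arg_maxP f (isT : predT q)) => u0 _ um; exists u0 => u; apply: um.
pose A u := f u == f u0.
have h_as := antisym_orientation o1 o2.
have exits d : A (vtx rho d) && ~~ A (vtx rho (al d)) ->
    f (vtx rho d) - f (vtx rho (al d)) = indic O1 d - indic O2 d.
  pose F d := (f (vtx rho d) - f (vtx rho (al d))) - (indic O1 d - indic O2 d).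
  have Fas : antisym F by move=> x; rewrite /F alK h_as; lia.
  have F0 : \sum_(x | A (vtx rho x)) F x = 0.
    rewrite sum_vtx big1 // => u _; rewrite sumrB lapf laplacian_cobound.
    by apply/eqP; rewrite subr_eq0; apply/eqP/eq_bigr => x _; rewrite opprB.
  have Fge x : A (vtx rho x) && ~~ A (vtx rho (al x)) -> 0 <= F x.
    move=> /andP[/eqP Ax Aax]; rewrite /F Ax.
    have: f (vtx rho (al x)) < f u0 by rewrite lt_neqAle Aax umax.
    by rewrite /indic; case: (_ \in O1); case: (_ \in O2); lia.
  move: F0; rewrite (flux_exits (fun x => A (vtx rho x)) Fas) => F0 dA.
  by have := psumr_eq0P Fge F0 dA; rewrite /F; lia.
have exitO d : A (vtx rho d) && ~~ A (vtx rho (al d)) -> (d \in O1) && (d \notin O2).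
  move=> dA; have := exits _ dA; move: dA => /andP[/eqP Ad Aad]; rewrite Ad.
  have: f (vtx rho (al d)) < f u0 by rewrite lt_neqAle Aad umax.
  by rewrite /indic; case: (_ \in O1); case: (_ \in O2) => //; lia.
suff allA u : A u by move=> u v; rewrite (eqP (allA u)) (eqP (allA v)).
(* If the root lies in [A], an outer vertex must enter [A] along [O1], against an exit in [O1]; if
   not, [u0] must leave [A] along [O2], which contains no exit. *)
apply: contraT => nAu; have [Aq|nAq] := boolP (A q).
  have: ~~ A q; last by rewrite Aq.
  apply: (conn_closed (A := fun v => ~~ A v) _ (r1 u)) nAu => d dO nAd.
  apply/negP => Aad; have := exitO (al d); rewrite alK Aad nAd => /(_ isT).
  by rewrite o1 dO.
suff: A q by rewrite (negPf nAq).
apply: (conn_closed (A := A) _ (r2 u0)); last exact: eqxx.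
move=> d dO Ad; apply: contraT => nA; have := exitO d; rewrite Ad nA => /(_ isT).
by rewrite dO andbF.
Qed.

Section Spherical.
Hypothesis sphere : spherical rho phi.
Variable T : {set D}.
Hypothesis uT : unicellular al rho T.

(* Fundamental cuts of the dual tree straighten h on the complement of T; what
   remains is a flow supported on T, which vanishes. *)
Lemma flow_cobound (h : D -> int) : antisym h ->
  (forall u, \sum_(d | vtx rho d == u) h d = 0) ->
  exists2 g : D -> int, (forall d, g (phi d) = g d) & h =1 cobound g.
Proof.
move=> h_as h0.
have aT d : (al d \in T) = (d \in T) by case: uT.
have maps' := dual_maps_sym maps.
have sphere' : spherical phi rho by rewrite /spherical addnC.
have uT' := unicellular_dual maps uT.
have [_ _ acT] := unicellular_spanning_tree maps sphere uT.
have [_ _ acT'] := unicellular_spanning_tree maps' sphere' uT'.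
have [d0|D0] := pickP (mem D); last by exists (fun=> 0) => // d; have := D0 d.
move=> _; set O := orient al rho T d0.
have oO : orientation al O by apply: (orient_orientation maps uT).
(* [A e] is the side of [e] in the dual tree without [e], and [O] picks one dart per edge. The ends
   of any other dual tree edge lie on the same side, so [cobound g] at a dart sees only its own
   term. *)
pose A e d := conn_in al phi (~: T :\ e :\ al e) (vtx phi e) (vtx phi d).
pose g d := - \sum_(e in ~: T :&: O) h e * (A e d)%:R.
have gphi d : g (phi d) = g d.
  by congr (- _); apply: eq_bigr => e _; rewrite /A vtx_rot.
have A_al e d : d \in ~: T -> d != e -> d != al e -> A e (al d) = A e d.
  move=> dT de dae; rewrite /A.
  have dTe : d \in ~: T :\ e :\ al e by rewrite !in_setD1 de dae.
  have adTe : al d \in ~: T :\ e :\ al e.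
    by apply: (closed_delete maps) => // x; rewrite !in_setC aT.
  apply/idP/idP => c; apply: (conn_trans c); last exact: conn_edge.
  by rewrite -{2}(alK d); apply: conn_edge.
have gO d : d \in ~: T :&: O -> cobound g d = h d.
  move=> dTO; rewrite /cobound /g opprK addrC -sumrB (bigD1 d) //= big1 => [|e /andP[eTO ed]].
    have /acT' : d \in ~: T by move: dTO; rewrite in_setI => /andP[].
    by rewrite /A conn_refl => /negPf->; rewrite mulr1 mulr0 subr0 addr0.
  have [[dT dO] [_ eO]] := (setIP dTO, setIP eTO).
  rewrite A_al ?subrr //; first by rewrite eq_sym.
  by apply: contraL dO => /eqP->; rewrite oO eO.
have gT d : d \notin T -> h d = cobound g d.
  move=> dT; have [dO|dO] := boolP (d \in O); first by rewrite gO // in_setI in_setC dT.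
  have := gO (al d); rewrite in_setI in_setC aT dT oO dO => /(_ isT).
  by rewrite antisym_cobound h_as => /oppr_inj.
exists g => // e; have [eT|/gT//] := boolP (e \in T).
(* [h'] is a flow vanishing off [T], so across the fundamental cut of [e] in [T] only [e] can carry
   it. *)
pose h' d := h d - cobound g d.
have h'_as : antisym h' by move=> d; rewrite /h' h_as antisym_cobound; lia.
pose B u := conn_in al rho (T :\ e :\ al e) (vtx rho e) u.
have : \sum_(d | B (vtx rho d)) h' d = 0.
  by rewrite sum_vtx big1 // => u _; rewrite sumrB h0 sum_cobound_dual // subr0.
rewrite (flux_exits (fun d => B (vtx rho d)) h'_as) (bigD1 e) /=; last first.
  by rewrite /B conn_refl acT.
rewrite big1 => [|d /andP[/andP[Bd nBd] de]].
  by rewrite addr0 /h' => /eqP; rewrite subr_eq0 => /eqP.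
have [dT|/gT] := boolP (d \in T); last by rewrite /h' => ->; rewrite subrr.
case: (eqVneq d (al e)) => [dae|dae].
  by move: Bd; rewrite dae /B (negPf (acT _ eT)).
case/negP: nBd; apply: conn_trans Bd _; apply: conn_edge.
by rewrite !in_setD1 de dae.
Qed.

End Spherical.
End Flows.

(** * Change of the base dart *)

Section Bicobound.
Variables (D : finType) (al rho phi : {perm D}).

(* h is a cut plus a cycle, the latter being the cut of face values g in the dual. *)
Definition bicobound (h : D -> int) : Prop :=
  exists f g : D -> int, [/\ forall d, f (rho d) = f d, forall d, g (phi d) = g d &
    forall d, h d = cobound al f d + cobound al g d].

Lemma bicobound_ext (h1 h2 : D -> int) : h1 =1 h2 -> bicobound h1 -> bicobound h2.
Proof. by move=> e [f [g [fr gp E]]]; exists f, g; split=> // d; rewrite -e. Qed.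

Lemma bicobound_sub (h1 h2 : D -> int) : bicobound h1 -> bicobound h2 ->
  bicobound (fun d => h1 d - h2 d).
Proof.
move=> [f1 [g1 [fr1 gp1 E1]]] [f2 [g2 [fr2 gp2 E2]]].
exists (fun d => f1 d - f2 d), (fun d => g1 d - g2 d).
split=> d; rewrite ?fr1 ?fr2 ?gp1 ?gp2 // E1 E2 /cobound; ring.
Qed.

Lemma bicobound_vtx (f : D -> int) : (forall d, f (rho d) = f d) -> bicobound (cobound al f).
Proof.
by move=> fr; exists f, (fun=> 0); split=> // d; rewrite {3}/cobound subrr addr0.
Qed.

Lemma bicobound0 : bicobound (fun=> 0).
Proof.
by apply: bicobound_ext (bicobound_vtx (f := fun=> 0) _) => // d; rewrite /cobound subrr.
Qed.

Lemma bicobound_add (h1 h2 : D -> int) : bicobound h1 -> bicobound h2 ->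
  bicobound (fun d => h1 d + h2 d).
Proof.
move=> b1 b2; apply: bicobound_ext (bicobound_sub b1 (bicobound_sub bicobound0 b2)) => d.
by rewrite sub0r opprK.
Qed.

End Bicobound.

Lemma bicobound_dual (D : finType) (al rho phi : {perm D}) (h : D -> int) :
  bicobound al rho phi h -> bicobound al phi rho h.
Proof. by move=> [f [g [fr gp E]]]; exists g, f; split=> // d; rewrite addrC E. Qed.

Section Spherical.
Variables (D : finType) (al rho phi : {perm D}).
Hypothesis maps : dual_maps al rho phi.
Hypothesis sphere : spherical rho phi.
Variable T : {set D}.
Hypothesis uT : unicellular al rho T.

Let alK : involutive al. Proof. by case: maps. Qed.
Let al_neq d : al d != d. Proof. by case: maps. Qed.
Let aT d : (al d \in T) = (d \in T). Proof. by case: uT. Qed.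

(** Adding the cut of [F] turns [h] into a flow, to which [flow_cobound] applies; conversely cycles
    have no divergence and only the cut counts. The sign between [F] and [f] arises because
    [laplacian] is minus the divergence of a coboundary. *)
Lemma bicoboundP (h : D -> int) : antisym al h ->
  (exists F : Vx rho -> int,
     forall u, \sum_(d | vtx rho d == u) h d = laplacian al rho F u) <->
  bicobound al rho phi h.
Proof.
move=> h_as; split=> [[F FE]|[f [g [fr gp E]]]].
  pose h' d := h d + cobound al (fun x => F (vtx rho x)) d.
  have h'_as : antisym al h' by move=> d; rewrite /h' h_as (antisym_cobound maps); ring.
  have [u|g gp E] := flow_cobound maps sphere uT h'_as.
    by rewrite big_split /= FE laplacian_cobound sumrN addNr.
  exists (fun x => - F (vtx rho x)), g; split=> // d; first by rewrite vtx_rot.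
  by rewrite -E /h' /cobound; ring.
exists (fun u => - f (val u)) => u; rewrite laplacian_cobound.
under eq_bigr do rewrite E.
rewrite big_split /= (sum_cobound_dual maps u gp) addr0; apply: eq_bigr => d _.
have fE x : f (val (vtx rho x)) = f x.
  by apply: (vtx_inv_eq fr); apply: val_inj; apply/eqP; apply: valP (vtx rho x).
by rewrite /cobound !fE; ring.
Qed.

Lemma pos_shift k d0 d : (k <= #|D|)%N ->
  pos al rho T (iter k (tour_step al rho T) d0) d =
  (if pos al rho T d0 d < k then pos al rho T d0 d + #|D| - k else pos al rho T d0 d - k)%N.
Proof.
move=> kle; set j := (if _ then _ else _).
have plt := pos_lt uT d0 d.
have itD : iter #|D| (tour_step al rho T) d0 = d0.
  by rewrite -(order_unicellular uT d0) iter_order //; apply: tour_step_inj.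
rewrite -{1}(iter_pos uT d0 d).
have -> : iter (pos al rho T d0 d) (tour_step al rho T) d0 =
          iter j (tour_step al rho T) (iter k (tour_step al rho T) d0).
  rewrite -iterD /j; case: ltnP => lt; last by rewrite subnK.
  by rewrite subnK ?iterD ?itD //; lia.
have jlt : (j < #|D|)%N by rewrite /j; case: ifP => lt; lia.
by rewrite (pos_iter uT).
Qed.

(** Moving the base by [k] steps sends the first [k] darts to the end of the tour and keeps the
    order within both blocks. *)
Lemma pos_shift_lt k d0 x y : (k <= #|D|)%N ->
  (pos al rho T (iter k (tour_step al rho T) d0) x <
   pos al rho T (iter k (tour_step al rho T) d0) y)%N =
  (if (pos al rho T d0 x < k)%N == (pos al rho T d0 y < k)%N
   then (pos al rho T d0 x < pos al rho T d0 y)%N else (pos al rho T d0 y < k)%N).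
Proof.
move=> kle; rewrite !pos_shift //.
have := pos_lt uT d0 x; have := pos_lt uT d0 y.
by case: ifP => lx; case: ifP => ly /=; [rewrite -!addnBA // ltn_add2r | lia | lia | lia].
Qed.

(** Up to a cut, the change does not depend on [T]: one unit moves from [d0] to [al d0]. *)
Lemma orient_shift d0 : exists2 f : D -> int, (forall d, f (rho d) = f d) &
  forall d, indic (orient al rho T (rho d0)) d - indic (orient al rho T d0) d =
            cobound al f d + (d == al d0)%:R - (d == d0)%:R.
Proof.
have pinj := pos_inj uT (d0 := d0); have plt := pos_lt uT d0.
have p0 := pos0 uT d0.
have pal d : pos al rho T d0 (al d) != pos al rho T d0 d by rewrite (inj_eq pinj).
have alal d : (al d == d0) = (d == al d0) by rewrite (can2_eq alK alK).
have Ddef d : (d == d0) = (pos al rho T d0 d == 0%N) by rewrite (pos_eq0 uT).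
have pp := plt (al d0); have Dpos : (0 < #|D|)%N by lia.
have [d0T|d0T] := boolP (d0 \in T); last first.
  (* [d0] goes from first to last place, so only its edge is reversed. *)
  have e1 : rho d0 = iter 1 (tour_step al rho T) d0 by rewrite /= /tour_step (negPf d0T).
  exists (fun=> 0) => // d; rewrite /cobound subrr add0r /indic !inE e1 !pos_shift_lt //.
  rewrite -alal !ltnS !leqn0 -!Ddef; have [dd|dd] := eqVneq d d0.
    by rewrite dd (negPf d0T) (negPf (al_neq d0)) p0 lt0n -Ddef al_neq.
  have [add|add] := eqVneq (al d) d0; last by rewrite eqxx !subrr.
  by rewrite -aT add (negPf d0T) p0 ltn0.
set m := pos al rho T d0 (al d0) in pp *.
have e1 : rho d0 = iter m.+1 (tour_step al rho T) d0.
  by rewrite iterS (iter_pos uT) /tour_step aT d0T alK.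
have [_ _ acT] := unicellular_spanning_tree maps sphere uT.
(* The positions 1 to [m] are the darts at the vertices beyond the tree edge of [d0]. Moving the
   base past them reverses the non-tree edges across this cut; the units at [d0] and [al d0]
   compensate the cut on the tree edge, which keeps its direction. *)
pose w d := conn_in al rho (T :\ d0 :\ al d0) (vtx rho (al d0)) (vtx rho d).
have avoid i : (i < #|D|)%N -> i != 0%N -> i != m ->
    iter i (tour_step al rho T) d0 \notin [set d0; al d0].
  move=> ilt i0 im; rewrite in_set2 Ddef -(inj_eq pinj) !(pos_iter uT) //.
  by rewrite negb_or i0 im.
have wE d : w d = (0 < pos al rho T d0 d <= m)%N.
  have [/andP[lt le]|nlt] := boolP (0 < pos al rho T d0 d <= m)%N.
    rewrite /w -(vtx_step_in al rho d0T) -{1}(iter_pos uT d0 d) -(prednK lt) iterSr.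
    by apply: conn_tour => i ilt; rewrite -iterSr; apply: avoid; lia.
  have c : conn_in al rho (T :\ d0 :\ al d0) (vtx rho d0) (vtx rho d).
    have [->|dd] := eqVneq d d0; first exact: conn_refl.
    have lt : (m < pos al rho T d0 d)%N by move: dd nlt; rewrite Ddef; lia.
    rewrite -(vtx_rot rho d0) e1 -{1}(iter_pos uT d0 d) -(subnK lt) iterD.
    apply: conn_tour => i ilt; rewrite -iterD; apply: avoid; move: (plt d); lia.
  apply/negbTE; apply: contra (acT _ d0T) => c'; apply: conn_trans c _.
  by apply: conn_sym c' => //; apply: (closed_delete maps).
exists (fun d => (w d)%:R) => d; first by rewrite /w vtx_rot.
have wT : d \in T -> d != d0 -> d != al d0 -> w (al d) = w d.
  move=> dT dd dad; have dS : d \in T :\ d0 :\ al d0 by rewrite !in_setD1 dad dd.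
  have adS := closed_delete maps aT dS.
  apply/idP/idP => c; apply: (conn_trans c); last exact: conn_edge.
  by rewrite -{2}(alK d); apply: conn_edge.
have m1 : (0 < m)%N by rewrite lt0n -Ddef al_neq.
rewrite /cobound /indic !inE e1 !pos_shift_lt // -alal.
have [dd|dd] := eqVneq d d0.
  by rewrite dd d0T (negPf (al_neq d0)) !wE p0 -/m leqnn ltnn m1 !ltnS leqnn. 
have [add|add] := eqVneq (al d) d0.
  have dE : d = al d0 by rewrite -add alK.
  by rewrite -aT add d0T !wE p0 dE -/m leqnn ltnn m1 !ltnS leqnn.
have wd (dT : d \in T) : w (al d) = w d by apply: (wT dT dd); rewrite -alal.
have posw x : x != d0 -> (pos al rho T d0 x <= m)%N = w x.
  by rewrite wE Ddef -lt0n => ->.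
rewrite addrK !ltnS !posw //; set b := (_ < _)%N.
have b1 : w d -> ~~ w (al d) -> b.
  by rewrite -!posw // -ltnNge => le1; apply: leq_ltn_trans.
have b2 : w (al d) -> ~~ w d -> ~~ b.
  by rewrite -!posw // -ltnNge -leqNgt => le1 lt1; apply: ltnW; apply: leq_ltn_trans lt1.
case: (boolP (d \in T)) => [/wd->|_]; first by rewrite eqxx !subrr.
move: b1 b2; case: (w d); case: (w (al d)) => //=; rewrite ?subrr // => b1 b2.
  by rewrite b1.
by rewrite (negPf (b2 _ _)).
Qed.

End Spherical.

(** * Orientations up to cuts and cycles *)

Section Orientations.
Variables (D : finType) (al rho phi : {perm D}).
Hypothesis maps : dual_maps al rho phi.

Let alK : involutive al. Proof. by case: maps. Qed.
Let al_neq d : al d != d. Proof. by case: maps. Qed.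

Definition equiv_orient (O O' : {set D}) : Prop :=
  bicobound al rho phi (fun d => indic O' d - indic O d).

Lemma equiv_orient_refl O : equiv_orient O O.
Proof. by apply: bicobound_ext (bicobound0 al rho phi) => d; rewrite subrr. Qed.

Lemma equiv_orient_trans O1 O2 O3 :
  equiv_orient O1 O2 -> equiv_orient O2 O3 -> equiv_orient O1 O3.
Proof. by move=> b1 b2; apply: bicobound_ext (bicobound_add b1 b2) => d; ring. Qed.

(** With [R] constant on vertices this reverses a cut; with [R] constant on faces it reverses a dual
    cut, that is, a cycle. *)
Definition cutflip (O : {set D}) (R : pred D) : {set D} :=
  [set d | (d \in O) (+) (R d (+) R (al d))].

Lemma cutflip_orientation O R : orientation al O -> orientation al (cutflip O R).
Proof. by move=> oO d; rewrite !inE oO alK addNb (addbC (R d)). Qed.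

(** No dart of [O] leaves [R], so all edges across point inwards and reversing them subtracts the
    whole cut. *)
Lemma cutflip_indic O (R : pred D) d : orientation al O ->
  (forall x, x \in O -> R x -> R (al x)) ->
  indic (cutflip O R) d - indic O d = - cobound al (fun x => (R x)%:R) d.
Proof.
move=> oO cR; rewrite /indic /cobound inE.
have := cR d; have := cR (al d); rewrite oO alK.
case: (d \in O); case: (R d); case: (R (al d)) => //= H1 H2;
  first [by have := H1 isT isT | by have := H2 isT isT].
Qed.

Lemma sum_pred1 u d : \sum_(x | vtx rho x == u) ((x == d)%:R : int) = (vtx rho d == u)%:R.
Proof.
rewrite big_mkcond (bigD1 d) //= eqxx big1 ?addr0 => [|x /negPf->]; last by rewrite if_same.
by case: (_ == u).
Qed.

(** [z] counts how often a directed path in [S] uses each dart. *)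
Lemma path_chain (S : {set D}) x y : conn_in al rho S x y ->
  exists z : D -> int, [/\ forall d, 0 <= z d, forall d, d \notin S -> z d = 0 &
    forall u, \sum_(d | vtx rho d == u) (z d - z (al d)) = (x == u)%:R - (y == u)%:R].
Proof.
move=> c; pose A y := exists z : D -> int,
  [/\ forall d, 0 <= z d, forall d, d \notin S -> z d = 0 &
    forall u, \sum_(d | vtx rho d == u) (z d - z (al d)) = (x == u)%:R - (y == u)%:R].
apply: (conn_closed (A := A) _ c) => [d dS [z [z0 zS zE]]|]; last first.
  by exists (fun=> 0); split=> // u; rewrite !subrr big1 // => d _; rewrite subrr.
exists (fun e => z e + (e == d)%:R); split=> [e|e eS|u].
- by rewrite addr_ge0.
- by rewrite zS // add0r; case: eqP eS dS => // -> /negPf->.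
transitivity (\sum_(e | vtx rho e == u) ((z e - z (al e)) + ((e == d)%:R - (e == al d)%:R))).
  by apply: eq_bigr => e _; rewrite (can2_eq alK alK); ring.
by rewrite big_split /= zE sumrB !sum_pred1; ring.
Qed.

Lemma conn_back (S : {set D}) (A : Vx rho -> Prop) x y :
  (forall d, d \in S -> conn_in al rho S (vtx rho (al d)) y ->
     A (vtx rho (al d)) -> A (vtx rho d)) ->
  conn_in al rho S x y -> A y -> A x.
Proof.
move=> AS /connectP[p]; elim: p x => [|u p IHp] x /=; first by move=> _ ->.
move=> /andP[/existsP[d /and3P[dS /eqP <- /eqP <-]] pp] ly Ay.
by apply: AS => //; [apply/connectP; exists p | apply: IHp].
Qed.

Section Spherical.
Hypothesis sphere : spherical rho phi.
Variable T : {set D}.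
Hypothesis uT : unicellular al rho T.

(* Minty: a dart lies in a directed cut or in a directed cycle, and the latter
   contains a level set of its dual potential; reverse either. *)
Lemma equiv_orient_mem O d : orientation al O ->
  exists O', [/\ orientation al O', equiv_orient O O' & d \in O'].
Proof.
move=> oO; have [dO|dO] := boolP (d \in O).
  by exists O; split=> //; apply: equiv_orient_refl.
suff [R [Rinv cR Rd nRad]] : exists R : pred D,
    [/\ (forall x, R (rho x) = R x) \/ (forall x, R (phi x) = R x),
        forall x, x \in O -> R x -> R (al x), R d & ~~ R (al d)].
  exists (cutflip O R); split; [exact: cutflip_orientation| |].
    have bR : bicobound al rho phi (cobound al (fun x => (R x)%:R)).
      case: Rinv => inv; first by apply: bicobound_vtx => x; rewrite inv.
      by apply/bicobound_dual/bicobound_vtx => x; rewrite inv.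
    apply: bicobound_ext (bicobound_sub (bicobound0 al rho phi) bR) => x.
    by rewrite sub0r cutflip_indic.
  by rewrite inE (negPf dO) Rd (negPf nRad).
have [c|nc] := boolP (conn_in al rho O (vtx rho d) (vtx rho (al d))); last first.
  exists (fun x => conn_in al rho O (vtx rho d) (vtx rho x)); split=> //.
  - by left=> x; rewrite vtx_rot.
  - by move=> x xO Rx; apply: conn_trans Rx _; apply: conn_edge.
  - exact: conn_refl.
have [z [z0 zO zE]] := path_chain c.
(* [al d] closes the path into a directed closed walk along [O], whose flow [h] has a face potential
   [g]. *)
pose w x := z x + (x == al d)%:R; pose h x := w x - w (al x).
have h_as : antisym al h by move=> x; rewrite /h alK opprB.
have [u|g gp hE] := flow_cobound maps sphere uT h_as.
  transitivity (\sum_(x | vtx rho x == u) ((z x - z (al x)) + ((x == al d)%:R - (x == d)%:R))).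
    by apply: eq_bigr => e _; rewrite /h /w (inj_eq (can_inj alK)); ring.
  by rewrite big_split /= zE sumrB !sum_pred1; ring.
have hO x : x \in O -> (x == al d)%:R <= h x.
  move=> xO; have axO : al x \notin O by rewrite oO xO.
  rewrite /h /w (zO _ axO); case: (eqVneq (al x) (al d)) => [e|_].
    by rewrite e oO dO in axO.
  by have := z0 x; lia.
(* Darts of [O] never lower [g], and [al d] strictly raises it; hence this level set is closed under
   [O] and separates [d] from [al d]. *)
exists (fun x => g d <= g x); split=> //.
- by right=> x; rewrite gp.
- by move=> x /hO; rewrite hE /cobound; case: eqP => _; lia.
- have /hO : al d \in O by rewrite oO.
  by rewrite eqxx hE /cobound alK -ltNge; lia.
Qed.

(** Every [O - c] is equivalent to an orientation. Quantifying over [O] makes the property additive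
    in [c], which reduces it to single darts. *)
Definition shiftable (c : D -> int) : Prop := forall O, orientation al O ->
  exists2 O', orientation al O' &
    bicobound al rho phi (fun x => indic O' x - indic O x + (c x - c (al x))).

Lemma shiftable_ext c1 c2 : (forall x, c1 x - c1 (al x) = c2 x - c2 (al x)) ->
  shiftable c1 -> shiftable c2.
Proof.
move=> e s1 O /s1[O' o' b]; exists O' => //.
by apply: bicobound_ext b => x; rewrite e.
Qed.

Lemma shiftable_add c1 c2 : shiftable c1 -> shiftable c2 -> shiftable (fun x => c1 x + c2 x).
Proof.
move=> s1 s2 O /s1[O1 /s2[O2 o2 b2] b1]; exists O2 => //.
by apply: bicobound_ext (bicobound_add b1 b2) => x; ring.
Qed.

(** In an equivalent orientation containing [d], reversing the edge of [d] realizes the shift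
    exactly. *)
Lemma shiftable_dart d : shiftable (fun x => (x == d)%:R).
Proof.
move=> O /(@equiv_orient_mem _ d)[O1 [o1 b1 dO1]].
exists [set x | (x \in O1) (+) ((x == d) || (x == al d))].
  move=> x; rewrite !inE o1 addNb (inj_eq (can_inj alK)) (can2_eq alK alK).
  by rewrite orbC.
apply: bicobound_ext b1 => x; rewrite /indic inE (can2_eq alK alK).
have [->|xd] := eqVneq x d; first by rewrite dO1 eq_sym (negPf (al_neq d)) /=; ring.
have [->|xd'] := eqVneq x (al d); first by rewrite o1 dO1 /=; ring.
by rewrite addbF; ring.
Qed.

Lemma shiftable_chain c : shiftable c.
Proof.
have s0 : shiftable (fun=> 0).
  move=> O oO; exists O => //; apply: bicobound_ext (bicobound0 al rho phi) => x; ring.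
have sn n d : shiftable (fun x => n%:R * (x == d)%:R).
  elim: n => [|n IHn]; first by apply: shiftable_ext s0 => x; ring.
  by apply: shiftable_ext (shiftable_add IHn (shiftable_dart d)) => x; ring.
have sz n d : shiftable (fun x => n * (x == d)%:R).
  case: n => n; first by apply: shiftable_ext (sn n d) => x; rewrite natz.
  (* Only [c x - c (al x)] matters, so -(n+1) copies of [d] act as n+1 copies of [al d]. *)
  apply: shiftable_ext (sn n.+1 (al d)) => x.
  by rewrite (inj_eq (can_inj alK)) !(can2_eq alK alK) NegzE natz; ring.
have : shiftable (fun x => \sum_(d <- enum D) c d * (x == d)%:R).
  elim: (enum D) => [|d s IHs].
    by apply: shiftable_ext s0 => x; rewrite !big_nil.
  by apply: shiftable_ext (shiftable_add (sz (c d) d) IHs) => x; rewrite !big_cons.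
apply: shiftable_ext => x.
have cE y : \sum_(d <- enum D) c d * (y == d)%:R = c y.
  rewrite big_enum (bigD1 y) //= eqxx mulr1 big1 ?addr0 // => d.
  by rewrite eq_sym => /negPf->; rewrite mulr0.
by rewrite !cE.
Qed.

End Spherical.
End Orientations.

(** * Making the root reachable in the map and in its dual *)

Section Reachability.
Variables (D : finType) (al rho phi : {perm D}).
Hypothesis maps : dual_maps al rho phi.

Let alK : involutive al. Proof. by case: maps. Qed.
Let maps' : dual_maps al phi rho. Proof. exact: dual_maps_sym. Qed.

Definition reach (O : {set D}) (d0 : D) : {set Vx rho} :=
  [set u | conn_in al rho O u (vtx rho d0)].

Variable d0 : D.
Hypothesis connected : forall x y, conn_in al rho [set: D] x y.

(* Reversing the directed cut around the vertices that reach d0 enlarges that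
   set, and a cut, being a flow in the dual, does not cross the dual one. *)
Lemma reach_grow O : orientation al O -> reach O d0 != setT ->
  exists O', [/\ orientation al O', equiv_orient al rho phi O O',
    (#|reach O d0| < #|reach O' d0|)%N &
    [set u | conn_in al phi (~: O) u (vtx phi d0)] \subset
    [set u | conn_in al phi (~: O') u (vtx phi d0)]].
Proof.
move=> oO nr; pose N d := ~~ conn_in al rho O (vtx rho d) (vtx rho d0).
have NO d : d \in O -> N d -> N (al d).
  by move=> dO; apply: contra => c; apply: conn_trans c; apply: conn_edge.
pose O' := cutflip al O N.
have oO' : orientation al O' by apply: (cutflip_orientation maps).
have NE d : indic O' d - indic O d = - cobound al (fun x => (N x)%:R) d.
  exact: (cutflip_indic maps).
have Nr d : N (rho d) = N d by rewrite /N vtx_rot.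
(* Paths to the root avoid [N], hence the reversed edges. *)
have sub : reach O d0 \subset reach O' d0.
  apply/subsetP => u; rewrite !inE => c.
  apply: (conn_back (A := fun v => conn_in al rho O' v (vtx rho d0)) _ c); last exact: conn_refl.
  move=> d dO c1 c2; apply: conn_trans c2; apply: conn_edge.
  have nN : ~~ N (al d) by rewrite negbK.
  by rewrite inE dO (negPf nN) (contraNF (NO _ dO) nN).
have [d /andP[Nd nNd]] : exists d, N d && ~~ N (al d).
  apply/existsP; apply: contraNT nr; rewrite negb_exists => /forallP nd.
  rewrite -subTset; apply/subsetP => u _; rewrite inE; apply: contraT => nu.
  suff: ~~ conn_in al rho O (vtx rho d0) (vtx rho d0) by rewrite conn_refl.
  apply: (conn_closed (A := fun v => ~~ conn_in al rho O v (vtx rho d0)) _ (connected u _)) nu.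
  by move=> d _ Nd; have := nd d; rewrite negb_and negbK [N d]Nd.
have dO : d \notin O by apply: contra nNd => /NO; apply.
exists O'; split=> //.
- have bN : bicobound al rho phi (cobound al (fun x => (N x)%:R)).
    by apply: bicobound_vtx => x; rewrite Nr.
  apply: bicobound_ext (bicobound_sub (bicobound0 al rho phi) bN) => x.
  by rewrite NE sub0r.
- apply/proper_card/properP; split=> //; exists (vtx rho d); last by rewrite inE.
  rewrite inE; have dO' : d \in O' by rewrite inE (negPf dO) Nd (negPf nNd).
  apply: conn_trans (conn_edge _ _ dO') _.
  by move/subsetP/(_ (vtx rho (al d))): sub; rewrite !inE; apply; rewrite negbK in nNd.
(* Exits of [B] avoid [O'], so the cut is nonnegative on them; its flux out of [B] is zero, so it
   vanishes there and the exits avoid [O] too. Hence no path along [~: O] enters [B] from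
   outside. *)
pose B d := conn_in al phi (~: O') (vtx phi d) (vtx phi d0).
have exitO x : B x && ~~ B (al x) -> x \notin O.
  have exitO' y : B y && ~~ B (al y) -> y \notin O'.
    move=> /andP[By nBy]; have: al y \in O'.
      apply: contraR nBy => ayO; apply: conn_trans By; rewrite -{2}(alK y).
      by apply: conn_edge; rewrite inE.
    by rewrite oO'.
  have Nge y : B y && ~~ B (al y) -> 0 <= cobound al (fun z => (N z)%:R) y.
    by move=> /exitO'/negPf yO'; have := NE y; rewrite /indic yO'; case: (y \in O); lia.
  have N0 : \sum_(y | B y) cobound al (fun z => (N z)%:R) y = 0.
    rewrite (sum_vtx (fun v => conn_in al phi (~: O') v (vtx phi d0))) big1 // => v _.
    by rewrite (sum_cobound_dual maps') // => y; rewrite Nr.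
  move: N0; rewrite (flux_exits maps B (antisym_cobound maps _)) => N0 xB.
  have := psumr_eq0P Nge N0 xB; have := NE x.
  by rewrite /indic (negPf (exitO' _ xB)); case: (x \in O); lia.
apply/subsetP => u; rewrite !inE => c; apply: contraT => nB.
suff: ~~ B d0 by rewrite /B conn_refl.
apply: (conn_closed (A := fun v => ~~ conn_in al phi (~: O') v (vtx phi d0)) _ c) nB.
move=> x; rewrite in_setC => xO nBx; apply/negP => Bax.
have := exitO (al x); rewrite alK [B (al x)]Bax [B x](negPf nBx) => /(_ isT).
by rewrite oO xO.
Qed.

End Reachability.

Section Normalize.
Variables (D : finType) (al rho phi : {perm D}) (d0 : D).
Hypothesis maps : dual_maps al rho phi.
Hypothesis connected : forall x y, conn_in al rho [set: D] x y.
Hypothesis connected' : forall x y, conn_in al phi [set: D] x y.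

Lemma equiv_orient_dual (O O' : {set D}) :
  equiv_orient al rho phi O O' -> equiv_orient al phi rho (~: O) (~: O').
Proof.
move=> b; apply: bicobound_dual.
apply: bicobound_ext (bicobound_sub (bicobound0 al rho phi) b) => d.
by rewrite /indic !inE; case: (d \in O); case: (d \in O').
Qed.

(** Each use of [reach_grow], in the map or in the dual, enlarges one reachable set without
    shrinking the other, so the bounded sum [m] increases. *)
Lemma equiv_orient_reach O : orientation al O ->
  exists O', [/\ orientation al O', equiv_orient al rho phi O O',
    forall u, conn_in al rho O' u (vtx rho d0) &
    forall u, conn_in al phi (~: O') u (vtx phi d0)].
Proof.
have maps' := dual_maps_sym maps.
pose m (O : {set D}) := (#|reach al rho O d0| + #|reach al phi (~: O) d0|)%N.
have mle O1 : (m O1 <= #|{: Vx rho}| + #|{: Vx phi}|)%N by rewrite leq_add ?max_card.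
have [n] := ubnP (#|{: Vx rho}| + #|{: Vx phi}| - m O)%N.
elim: n O => // n IHn O mlt oO.
have next O1 : orientation al O1 -> equiv_orient al rho phi O O1 -> (m O < m O1)%N ->
    exists O', [/\ orientation al O', equiv_orient al rho phi O O',
      forall u, conn_in al rho O' u (vtx rho d0) &
      forall u, conn_in al phi (~: O') u (vtx phi d0)].
  move=> o1 b1 lt1; have [|//|O' [o' b' r1 r2]] := IHn O1.
    by move: mlt (mle O1) lt1; lia.
  by exists O'; split=> //; apply: equiv_orient_trans b1 b'.
have oOC (P : {set D}) : orientation al P -> orientation al (~: P).
  by move=> oP d; rewrite !in_setC oP.
have [r1|nr1] := eqVneq (reach al rho O d0) setT; last first.
  have [O1 [o1 b1 lt1 /subset_leq_card le1]] := reach_grow maps connected oO nr1.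
  by apply: (next O1) => //; rewrite /m -addSn leq_add.
have [r2|nr2] := eqVneq (reach al phi (~: O) d0) setT; last first.
  have [O1 [o1 b1 lt1]] := reach_grow maps' connected' (oOC _ oO) nr2.
  rewrite setCK => /subset_leq_card le1; apply: (next (~: O1)); first exact: oOC.
    by have := equiv_orient_dual (bicobound_dual b1); rewrite setCK => b; apply: bicobound_dual.
  by rewrite /m setCK -addnS leq_add.
exists O; split=> // [|u|u]; first exact: equiv_orient_refl.
  by have := in_setT u; rewrite -r1 inE.
by have := in_setT u; rewrite -r2 inE.
Qed.

End Normalize.

(** * Orientations come from trees *)

(* On the edges first met within k steps, the tour of T takes the decisions that
   orient T d0 = O would force. *)
Definition agrees (D : finType) (al rho : {perm D}) (O T : {set D}) d0 k : Prop :=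
  forall d, (pos al rho T d0 d < k)%N -> (pos al rho T d0 d < pos al rho T d0 (al d))%N ->
    (d \in T) = (al d \in O).

Lemma pos_dual (D : finType) (al rho phi : {perm D}) (T : {set D}) d0 d :
  dual_maps al rho phi -> pos al phi (~: T) d0 d = pos al rho T d0 d.
Proof.
move=> maps; rewrite /pos; congr index.
by apply: eq_map => k; apply: eq_iter; apply: (tour_step_dual maps).
Qed.

Lemma agrees_dual (D : finType) (al rho phi : {perm D}) (O T : {set D}) d0 k :
  dual_maps al rho phi -> agrees al rho O T d0 k -> agrees al phi (~: O) (~: T) d0 k.
Proof. by move=> maps a d; rewrite !(pos_dual _ _ _ maps) !in_setC => lt1 /a ->. Qed.

(** * Exchanging an edge at the first disagreement *)

Section Exchange.
Variables (D : finType) (al rho phi : {perm D}).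
Hypothesis maps : dual_maps al rho phi.

Let alK : involutive al. Proof. by case: maps. Qed.
Let al_neq d : al d != d. Proof. by case: maps. Qed.
Let phiE d : phi d = rho (al d). Proof. by case: maps. Qed.

Section Unicellular.
Variables (T : {set D}) (d0 : D).
Hypothesis uT : unicellular al rho T.
Notation f := (tour_step al rho T).
Notation p := (pos al rho T d0).

Let aT d : (al d \in T) = (d \in T). Proof. by case: uT. Qed.

(** The tree darts walked in a stretch of the tour form a walk between its end vertices; cutting
    through does not move. *)
Lemma tour_chain j n u : (j + n < #|D|)%N ->
  \sum_(d | vtx rho d == u) ((((d \in T) && (j <= p d < j + n)%N)%:R : int)
    - ((al d \in T) && (j <= p (al d) < j + n)%N)%:R) =
  (vtx rho (iter j f d0) == u)%:R - (vtx rho (iter (j + n) f d0) == u)%:R.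
Proof.
elim: n => [|n IHn] lt.
  rewrite addn0 subrr big1 // => d _.
  have z0 i : (j <= i < j)%N = false by lia.
  by rewrite !z0 !andbF subrr.
rewrite addnS in lt *; have {}IHn := IHn (ltnW lt).
set y := iter (j + n) f d0 in IHn *.
have py : p y = (j + n)%N by rewrite (pos_iter uT) // ltnW.
have zS d : (((d \in T) && (j <= p d < (j + n).+1)%N)%:R : int) =
    ((d \in T) && (j <= p d < j + n)%N)%:R + ((y \in T) && (d == y))%:R.
  have [->|dy] := eqVneq d y.
    by rewrite py leq_addr ltnn ltnS leqnn /= andbF add0r.
  have dpos : p d != (j + n)%N by rewrite -py (inj_eq (pos_inj uT (d0 := d0))).
  rewrite andbF addr0; suff -> : (j <= p d < (j + n).+1)%N = (j <= p d < j + n)%N by [].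
  by lia.
under eq_bigr do rewrite !zS.
have [yT|yT] := boolP (y \in T); last first.
  rewrite iterS vtx_step_notin // -IHn; apply: eq_bigr => d _.
  by rewrite /= !addr0.
rewrite iterS vtx_step_in //=.
transitivity (\sum_(d | vtx rho d == u) ((((d \in T) && (j <= p d < j + n)%N)%:R
    - ((al d \in T) && (j <= p (al d) < j + n)%N)%:R) + ((d == y)%:R - (d == al y)%:R)) : int).
  by apply: eq_bigr => d _; rewrite (can2_eq alK alK); ring.
by rewrite big_split /= IHn sumrB !sum_pred1 /y; ring.
Qed.

Section Disagreement.
Hypothesis sphere : spherical rho phi.
Variables (O : {set D}) (x : D).
Hypothesis oO : orientation al O.
Hypothesis agr : agrees al rho O T d0 (p x).
Hypothesis x_first : (p x < p (al x))%N.
Hypothesis xT : x \notin T.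
Hypothesis xO : al x \in O.

(* Otherwise the fundamental cycle of x is directed, so that its dual potential
   is lower inside than at d0, and the inside cannot reach d0 in the dual. *)
Lemma exchange_dart : (forall u, conn_in al phi (~: O) u (vtx phi d0)) ->
  exists2 e, e \in T & (p x < p e < p (al x))%N && (p (al x) < p (al e))%N.
Proof.
move=> reach'.
have [/existsP[e /andP[eT eP]]|none] :=
  boolP [exists e, (e \in T) && ((p x < p e < p (al x))%N && (p (al x) < p (al e))%N)].
  by exists e.
have axT : al x \notin T by rewrite aT.
have pinj := @pos_inj _ _ _ _ uT d0.
(* The walk of the tour from [x] to [al x], closed by [al x]. *)
pose z d := ((d \in T) && (p x < p d < p (al x))%N)%:R + (d == al x)%:R : int.
pose h d := z d - z (al d).
have h_as : antisym al h by move=> d; rewrite /h alK opprB.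
have [u|g gp hE] := flow_cobound maps sphere uT h_as.
  pose n := (p (al x) - (p x).+1)%N.
  have nE : ((p x).+1 + n = p (al x))%N by rewrite subnKC.
  transitivity (\sum_(d | vtx rho d == u) (
    (((d \in T) && (p x < p d < (p x).+1 + n)%N)%:R
    - ((al d \in T) && (p x < p (al d) < (p x).+1 + n)%N)%:R)
      + ((d == al x)%:R - (d == x)%:R)) : int).
    by apply: eq_bigr => d _; rewrite /h /z nE (inj_eq (can_inj alK)); ring.
  rewrite big_split /= tour_chain ?nE ?(pos_lt uT) // sumrB !sum_pred1.
  by rewrite iterS !(iter_pos uT) vtx_step_notin //; ring.
have hx : h x = -1.
  by rewrite /h /z (negPf xT) (negPf axT) eqxx eq_sym (negPf (al_neq x)).
(* With no interlaced edge, a dart of positive net flow other than [al x] has its reverse walked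
   before [x], where agreement puts the dart in [O]. *)
have hO d : 0 < h d -> d \in O.
  have [->//|dax] := eqVneq d (al x).
  rewrite /h /z (negPf dax) (can2_eq alK alK) alK aT.
  have [dT|dT] := boolP (d \in T); last by rewrite /=; case: (d == x).
  have dx : d != x by apply: contraNneq xT => <-.
  move=> hp; have /andP[lt1 lt2] : (p x < p d < p (al x))%N.
    by move: hp; case: (_ < p d < _)%N => //=; rewrite (negPf dx); case: (_ && _).
  have nlt : ~~ (p x < p (al d) < p (al x))%N.
    by apply: contraL hp => ->; rewrite lt1 lt2 (negPf dx).
  have adx : p (al d) != p x by rewrite (inj_eq pinj) (can2_eq alK alK).
  have adax : p (al d) != p (al x) by rewrite (inj_eq pinj) (inj_eq (can_inj alK)).
  have nlt2 : ~~ (p (al x) < p (al d))%N.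
    by apply: contra none => lt3; apply/existsP; exists d; rewrite dT lt1 lt2.
  have lt4 : (p (al d) < p x)%N by move: nlt nlt2 adx adax; lia.
  have := agr (d := al d) lt4; rewrite alK aT dT => <- //.
  exact: ltn_trans lt4 lt1.
(* In the dual the tour changes face only at darts outside [T], and those met before [x] carry no
   flow. *)
have gconst i : (i <= p x)%N -> g (iter i f d0) = g d0.
  elim: i => // i IHi lt; rewrite -(IHi (ltnW lt)) iterS; set y := iter i f d0.
  have py : p y = i by rewrite (pos_iter uT) // (ltn_trans lt) // (pos_lt uT).
  rewrite /tour_step; case: ifPn => yT; first by rewrite -phiE gp.
  rewrite -{1}(alK y) -phiE gp.
  have h0 : h y = 0.
    rewrite /h /z aT (negPf yT) /= (inj_eq (can_inj alK)).
    have -> : (y == al x) = false.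
      by apply/eqP => e; move: py lt x_first; rewrite e; lia.
    have -> : (y == x) = false.
      by apply/eqP => e; move: py lt; rewrite e; lia.
    by rewrite subrr.
  by move: (hE y); rewrite h0 /cobound; lia.
have gx : g (al x) < g d0.
  rewrite -(gconst (p x)) // (iter_pos uT).
  by move: (hE x); rewrite hx /cobound; lia.
have gE y : g (val (vtx phi y)) = g y.
  by apply: (vtx_inv_eq gp); apply: val_inj; apply/eqP; apply: valP (vtx phi y).
suff: g d0 < g d0 by rewrite ltxx.
rewrite -{1}gE.
have r := reach' (vtx phi (al x)).
apply: (conn_closed (A := fun v => g (val v) < g d0) _ r); last by rewrite gE.
move=> d; rewrite in_setC !gE => dO gd; rewrite ltNge; apply: contra dO => ge.
by apply: hO; rewrite hE /cobound; lia.
Qed.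

(** The darts of the interlaced edges of [x] and [e] cut the tour into five segments. The exchange
    swaps the successors of the two darts of each pair, so the segments follow in the order first,
    fourth, third, second, fifth: still one cycle, unchanged up to [x]. *)
Lemma exchange_unicellular e : e \in T ->
  (p x < p e < p (al x))%N && (p (al x) < p (al e))%N ->
  let T' := (x |: (al x |: T)) :\ e :\ al e in
  [/\ unicellular al rho T',
      forall i, (i <= p x)%N -> iter i (tour_step al rho T') d0 = iter i f d0,
      x \in T' & forall d, (p d < p x)%N -> (d \in T') = (d \in T)].
Proof.
move=> eT /andP[/andP[lt1 lt2] lt3] T'.
have pinj := @pos_inj _ _ _ _ uT d0.
have T'E d : (d \in T') = [&& d != al e, d != e & [|| d == x, d == al x | d \in T]].
  by rewrite !inE.
have neq a b : p a != p b -> (a == b) = false.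
  by move=> /negPf; rewrite (inj_eq pinj).
have xT' : x \in T' by rewrite T'E eqxx !neq //; lia.
have axT : al x \notin T by rewrite aT.
have same d : (p d < p x)%N -> (d \in T') = (d \in T).
  by move=> lt; rewrite T'E !neq //; lia.
have aT' d : (al d \in T') = (d \in T').
  rewrite !T'E !(can2_eq alK alK) !alK aT.
  by case: (d == e); case: (d == al e); case: (d == x); case: (d == al x).
pose f' := tour_step al rho T'.
have f'_inj : injective f' by apply: tour_step_inj.
have f'E d : p d \notin [:: p x; p e; p (al x); p (al e)] -> f' d = f d.
  rewrite !inE !(inj_eq pinj) !negb_or => /and4P[n1 n2 n3 n4].
  by rewrite /f' /tour_step T'E n4 n2 (negPf n1) (negPf n3).
have f'x : f' x = f (al x) by rewrite /f' /tour_step xT' (negPf axT).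
have f'ax : f' (al x) = f x by rewrite /f' /tour_step aT' xT' (negPf xT) alK.
have f'e : f' e = f (al e).
  by rewrite /f' /tour_step T'E eqxx andbF aT eT alK.
have f'ae : f' (al e) = f e by rewrite /f' /tour_step T'E eqxx eT.
have pit i : (i < #|D|)%N -> p (iter i f d0) = i by apply: pos_iter.
have pale := pos_lt uT d0 (al e).
have seg a b : (a <= b <= #|D|)%N ->
    (forall i, (a <= i < b)%N -> i \notin [:: p x; p e; p (al x); p (al e)]) ->
    fconnect f' (iter a f d0) (iter b f d0).
  elim: b => [|b IHb] /andP[ab bD] nsp.
    by move: ab; rewrite leqn0 => /eqP->; apply: connect0.
  case: (ltngtP a b.+1) ab => // [ltab _|-> _]; last exact: connect0.
  apply: connect_trans (IHb _ _) _ => [|i ib|]; [by lia | by apply: nsp; lia |].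
  by apply: connect1; apply/eqP; rewrite /= f'E ?pit //; apply: nsp; lia.
have c0 i : (i <= p x)%N -> fconnect f' d0 (iter i f d0).
  by move=> le; apply: (seg 0%N i) => [|j]; rewrite ?inE; lia.
have cx : fconnect f' d0 x by have := c0 _ (leqnn _); rewrite (iter_pos uT).
have step1 a b : f' a = f b -> fconnect f' d0 a -> fconnect f' d0 (iter (p b).+1 f d0).
  move=> fab ca; rewrite iterS (iter_pos uT) -fab.
  exact: connect_trans ca (fconnect1 _ _).
have c1 i : (p (al x) < i <= p (al e))%N -> fconnect f' d0 (iter i f d0).
  move=> le; apply: connect_trans (step1 _ _ f'x cx) (seg _ _ _ _) => [|j]; rewrite ?inE; lia.
have cae : fconnect f' d0 (al e).
  by rewrite -(iter_pos uT d0 (al e)); apply: c1; rewrite lt3 leqnn.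
have c2 i : (p e < i <= p (al x))%N -> fconnect f' d0 (iter i f d0).
  move=> le; apply: connect_trans (step1 _ _ f'ae cae) (seg _ _ _ _) => [|j]; rewrite ?inE; lia.
have cax : fconnect f' d0 (al x).
  by rewrite -(iter_pos uT d0 (al x)); apply: c2; rewrite lt2 leqnn.
have c3 i : (p x < i <= p e)%N -> fconnect f' d0 (iter i f d0).
  move=> le; apply: connect_trans (step1 _ _ f'ax cax) (seg _ _ _ _) => [|j]; rewrite ?inE; lia.
have ce : fconnect f' d0 e.
  by rewrite -(iter_pos uT d0 e); apply: c3; rewrite lt1 leqnn.
have c4 i : (p (al e) < i <= #|D|)%N -> fconnect f' d0 (iter i f d0).
  move=> le; apply: connect_trans (step1 _ _ f'e ce) (seg _ _ _ _) => [|j]; rewrite ?inE; lia.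
have call d : fconnect f' d0 d.
  rewrite -(iter_pos uT d0 d); have lt := pos_lt uT d0 d.
  have [|l1] := leqP (p d) (p x); first exact: c0.
  have [l2|l2] := leqP (p d) (p e); first by apply: c3; rewrite l1 l2.
  have [l3|l3] := leqP (p d) (p (al x)); first by apply: c2; rewrite l2 l3.
  have [l4|l4] := leqP (p d) (p (al e)); first by apply: c1; rewrite l3 l4.
  by apply: c4; rewrite l4 ltnW.
split=> //.
  split=> // a b; apply: connect_trans (call b).
  by rewrite fconnect_sym.
elim=> // i IHi lt; rewrite !iterS IHi ?(ltnW lt) // -/f' f'E // pit.
  by rewrite !inE; lia.
by lia.
Qed.

Lemma agrees_exchange : (forall u, conn_in al phi (~: O) u (vtx phi d0)) ->
  exists T', unicellular al rho T' /\ agrees al rho O T' d0 (p x).+1.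
Proof.
move=> /exchange_dart[e eT eP].
have [uT' it xT' same] := exchange_unicellular eT eP.
set T' := (_ :\ _ :\ _) in uT' it xT' same.
exists T'; split=> // d lt lt'.
have pp y : (pos al rho T' d0 y <= p x)%N -> pos al rho T' d0 y = p y.
  move=> le; have plt := pos_lt uT' d0 y.
  by rewrite -{2}(iter_pos uT' d0 y) it // (pos_iter uT).
have pp' y : (p y <= p x)%N -> pos al rho T' d0 y = p y.
  move=> le; have plt := pos_lt uT d0 y.
  by rewrite -{1}(iter_pos uT d0 y) -it // (pos_iter uT').
have dE := pp d lt; move: lt lt'; rewrite dE ltnS leq_eqVlt.
rewrite (inj_eq (@pos_inj _ _ _ _ uT d0)); case: eqVneq => [->|dx] /=.
  by rewrite xT' xO.
move=> lt lt'; rewrite same //; apply: agr => //.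
rewrite ltnNge; apply/negP => le.
by move: lt'; rewrite pp' ?(leq_trans le (ltnW lt)) // ltnNge le.
Qed.

End Disagreement.
End Unicellular.
End Exchange.

(** Starting from any tree, agreement is lengthened one position at a time; over the whole tour it
    means equality of orientations. *)
Lemma orientation_orient (D : finType) (al rho phi : {perm D}) (T O : {set D}) d0 :
  dual_maps al rho phi -> spherical rho phi -> unicellular al rho T -> orientation al O ->
  (forall u, conn_in al rho O u (vtx rho d0)) ->
  (forall u, conn_in al phi (~: O) u (vtx phi d0)) ->
  exists2 T', unicellular al rho T' & orient al rho T' d0 = O.
Proof.
move=> maps sphere uT oO r r'; have maps' := dual_maps_sym maps.
have [alK _ _] := maps.
suff: exists2 T', unicellular al rho T' & agrees al rho O T' d0 #|D|.
  move=> {T uT} [T uT agr]; exists T => //; apply/setP => d; rewrite inE.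
  have aT : (al d \in T) = (d \in T) by case: uT.
  have [lt|] := boolP (pos al rho T d0 d < pos al rho T d0 (al d))%N.
    by rewrite (agr d) ?(pos_lt uT) // oO; case: (d \in O).
  rewrite -(pos_al maps uT) addbF => lt.
  by rewrite -aT (agr (al d)) ?(pos_lt uT) // alK.
elim: {-2}#|D| (leqnn #|D|) => [|k IHk] lt; first by exists T.
move: (IHk (ltnW lt)) => {T uT IHk} [T uT agr].
have [x px] : exists x, pos al rho T d0 x = k.
  by exists (iter k (tour_step al rho T) d0); rewrite (pos_iter uT).
have agrS : (pos al rho T d0 x < pos al rho T d0 (al x) -> (x \in T) = (al x \in O))%N ->
    agrees al rho O T d0 k.+1.
  move=> ex d; rewrite ltnS leq_eqVlt -px (inj_eq (pos_inj uT (d0 := d0))).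
  by case: eqVneq => [->|dx] //=; rewrite px; apply: agr.
have [lt'|ge] := boolP (pos al rho T d0 x < pos al rho T d0 (al x))%N; last first.
  by exists T => //; apply: agrS => lt'; rewrite lt' in ge.
have [e|ne] := eqVneq (x \in T) (al x \in O); first by exists T => //; apply: agrS.
have agr' : agrees al rho O T d0 (pos al rho T d0 x) by rewrite px.
have [xT|xT] := boolP (x \in T); last first.
  have xO : al x \in O by move: ne; rewrite (negPf xT); case: (al x \in O).
  have [T' [uT' aT']] := agrees_exchange maps uT sphere agr' lt' xT xO r'.
  by exists T' => //; rewrite -px.
(* A dart wrongly walked is wrongly cut in the dual, where the exchange applies to [~: O] and
   [~: T]. *)
have xO : al x \in ~: O by move: ne; rewrite xT in_setC; case: (al x \in O).
have sphere' : spherical phi rho by rewrite /spherical addnC.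
have := agrees_exchange maps' (unicellular_dual maps uT) sphere' (x := x) (O := ~: O) (d0 := d0).
rewrite !(pos_dual _ _ _ maps) in_setC xT setCK => /(_ (agrees_dual maps agr') lt' isT xO r).
move=> [T' [uT' aT']]; exists (~: T'); first exact: unicellular_dual maps' uT'.
by have := agrees_dual maps' aT'; rewrite setCK px.
Qed.

(** * The action *)

(** The tours coincide step by step: at an edge met again the decision repeats the earlier one, and
    at an edge first met it is read off the orientation. *)
Lemma orient_inj (D : finType) (al rho phi : {perm D}) (T1 T2 : {set D}) d0 :
  dual_maps al rho phi -> unicellular al rho T1 -> unicellular al rho T2 ->
  orient al rho T1 d0 = orient al rho T2 d0 -> T1 = T2.
Proof.
move=> maps u1 u2 eO.
have aT1 d : (al d \in T1) = (d \in T1) by case: u1.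
have aT2 d : (al d \in T2) = (d \in T2) by case: u2.
pose f1 := tour_step al rho T1; pose f2 := tour_step al rho T2.
have E k : (k <= #|D|)%N -> forall i, (i < k)%N ->
    iter i f1 d0 = iter i f2 d0 /\ (iter i f1 d0 \in T1) = (iter i f1 d0 \in T2).
  elim: k => // k IHk klt i; rewrite ltnS leq_eqVlt => /predU1P[{i}->|]; last first.
    by apply: IHk; apply: ltnW.
  have {}IHk := IHk (ltnW klt).
  have ek : iter k f1 d0 = iter k f2 d0.
    case: k IHk {klt} => // k IHk; have [e1 e2] := IHk k (ltnSn k).
    by rewrite !iterS -e1 /f1 /f2 /tour_step e2.
  split=> //; set x := iter k f1 d0.
  have p1 : pos al rho T1 d0 x = k by rewrite (pos_iter u1).
  have p2 : pos al rho T2 d0 x = k by rewrite /x ek (pos_iter u2).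
  have [lt|ge] := ltnP (pos al rho T1 d0 (al x)) k.
    by have [_] := IHk _ lt; rewrite (iter_pos u1) aT1 aT2.
  have ge2 : (k <= pos al rho T2 d0 (al x))%N.
    rewrite leqNgt; apply/negP => lt2; have [e _] := IHk _ lt2.
    move: ge; rewrite -{1}(iter_pos u2 d0 (al x)) -e (pos_iter u1) ?(pos_lt u2) //.
    by rewrite leqNgt lt2.
  have := eO => /setP/(_ x); rewrite !inE.
  have := pos_al maps u1 d0 x; have := pos_al maps u2 d0 x.
  rewrite p1 p2 !ltnNge ge ge2 /= => /esym/negbFE -> /esym/negbFE ->.
  by move/addIb.
apply/setP => d; have [_] := E #|D| (leqnn _) _ (pos_lt u1 d0 d).
by rewrite (iter_pos u1).
Qed.

Section Bernardi.
Variables (D : finType) (al rho phi : {perm D}).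
Hypothesis maps : dual_maps al rho phi.
Hypothesis sphere : spherical rho phi.

Let alK : involutive al. Proof. by case: maps. Qed.

Lemma bnd_vtx c u : bnd al rho c u = - \sum_(d | vtx rho d == u) (c d - c (al d)).
Proof.
rewrite ffunE.
transitivity (\sum_d (c d * (vtx rho (al d) == u)%:R - c d * (vtx rho d == u)%:R)).
  by apply: eq_bigr => d _; rewrite mulrBr !natz.
rewrite sumrB (reindex_inj (@perm_inj _ al)) /= sumrB opprB [in RHS]big_mkcond.
congr (_ - _); last rewrite [RHS]big_mkcond; apply: eq_bigr => d _.
  by rewrite alK; case: ifP => _; rewrite ?mulr1 ?mulr0.
by case: ifP => _; rewrite ?mulr1 ?mulr0.
Qed.

Definition torsor_rel d0 (c : D -> int) (T T' : {set D}) : Prop :=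
  bicobound al rho phi (fun d => indic (orient al rho T' d0) d - indic (orient al rho T d0) d
                                 + (c d - c (al d))).

Section Trees.
Variables (d0 : D) (T T' : {set D}).
Hypotheses (uT : unicellular al rho T) (uT' : unicellular al rho T').

(** In the difference of the divisors the root corrections cancel, leaving the divergence of [h];
    [c] enters with a plus because [bnd] is minus a divergence. *)
Lemma torsor_relP c : torsor_rel d0 c T T' <->
  lin_equiv al rho (bernardi al rho d0 T')
    [ffun u => bernardi al rho d0 T u + bnd al rho c u].
Proof.
pose h d := indic (orient al rho T' d0) d - indic (orient al rho T d0) d + (c d - c (al d)).
have h_as : antisym al h.
  have oT := orient_orientation maps uT d0; have oT' := orient_orientation maps uT' d0.
  by move=> d; rewrite /h (antisym_orientation oT' oT) alK; ring.
have hE u : bernardi al rho d0 T' u -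
    [ffun u => bernardi al rho d0 T u + bnd al rho c u] u = \sum_(d | vtx rho d == u) h d.
  rewrite ffunE !(bernardi_orient maps sphere) // bnd_vtx [RHS]big_split /= [in RHS]sumrB.
  by rewrite /indic; ring.
have [to from] := bicoboundP maps sphere uT h_as.
split=> [/from[F FE]|[F FE]]; first by exists F => u; rewrite hE.
by apply: to; exists F => u; rewrite -hE.
Qed.

(** By [orient_shift] both orientations change by the same chain up to cuts. *)
Lemma torsor_rel_rot c : torsor_rel d0 c T T' -> torsor_rel (rho d0) c T T'.
Proof.
move=> b; have [f1 fr1 E1] := orient_shift maps sphere uT d0.
have [f2 fr2 E2] := orient_shift maps sphere uT' d0.
have b1 := @bicobound_vtx _ al rho phi _ fr1.
have b2 := @bicobound_vtx _ al rho phi _ fr2.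
apply: bicobound_ext (bicobound_add b (bicobound_sub b2 b1)) => d.
have := E1 d; have := E2 d; lia.
Qed.

Lemma bernardi_is_break : is_break al rho (bernardi al rho d0 T).
Proof.
exists T; split; first exact: (unicellular_spanning_tree maps sphere).
exists [set d | (d \notin T) && (pos al rho T d0 d < pos al rho T d0 (al d))%N].
split=> [d|d dT|]; first by rewrite inE => /andP[].
  have aT : (al d \in T) = (d \in T) by case: uT.
  by rewrite !inE aT dT alK (pos_al maps uT) /=; case: (_ < _)%N.
apply/ffunP => u; rewrite !ffunE; apply: eq_bigl => d.
by rewrite inE -andbA [X in _ && X]andbC.
Qed.

(* The root-directed tree edges complete a break divisor to an orientation in
   which every vertex reaches the root. *)
Lemma break_unique B : is_break al rho B -> lin_equiv al rho B (bernardi al rho d0 T) ->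
  B = bernardi al rho d0 T.
Proof.
move=> [T1 [/(spanning_tree_unicellular maps) u1 [P [PT Pal ->]]]] [f fE].
have aT1 d : (al d \in T1) = (d \in T1) by case: u1.
pose O := orient al rho T1 d0.
pose O1 := [set d | if d \in T1 then d \in O else d \in P].
have oO := orient_orientation maps u1 d0.
have O1E d : (d \in O1) = if d \in T1 then d \in O else d \in P by rewrite inE.
have o1 : orientation al O1.
  move=> d; rewrite !O1E aT1; case: ifPn => dT; first exact: oO.
  by have := Pal _ dT; case: (d \in P); case: (al d \in P).
have r1 u : conn_in al rho O1 u (vtx rho d0).
  apply: conn_sub (orient_reach maps u1 d0 u) => d; rewrite in_setI => /andP[dT dO].
  by rewrite O1E dT.
have BE u : [ffun u => \sum_(d in P | vtx rho d == u) (1 : int)] u =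
    \sum_(d | vtx rho d == u) indic O1 d - (u != vtx rho d0)%:R.
  have O1T : {in T1, O1 =i O} by move=> d dT; rewrite O1E dT.
  rewrite ffunE (orient_degree maps sphere u1 u O1T) addrK; apply: eq_bigl => d.
  rewrite O1E; case: ifPn => dT //=.
  by case: (boolP (d \in P)) => // /PT; rewrite dT.
have r2 u : conn_in al rho (orient al rho T d0) u (vtx rho d0).
  by apply: conn_sub (orient_reach maps uT d0 u) => d; rewrite in_setI => /andP[].
have fc : forall u v, f u = f v.
  apply: (laplacian_reach_const maps o1 (orient_orientation maps uT d0) r1 r2) => u.
  by rewrite -fE BE (bernardi_orient maps sphere uT) sumrB /indic; ring.
apply/ffunP => u; apply/eqP; rewrite -subr_eq0 fE /laplacian big1 // => d _.
by rewrite (fc u (vtx rho (al d))) subrr.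
Qed.

(** Equal divisors make the orientations differ by a flow, hence by a face potential [g]. The
    maximum argument in the dual, where both reversed orientations reach the root, makes [g]
    constant. *)
Lemma bernardi_inj : bernardi al rho d0 T = bernardi al rho d0 T' -> T = T'.
Proof.
move=> eb; apply: (orient_inj maps uT uT' (d0 := d0)).
have maps' := dual_maps_sym maps.
have o1 := orient_orientation maps uT d0; have o2 := orient_orientation maps uT' d0.
have h0 u : \sum_(d | vtx rho d == u)
    (indic (orient al rho T d0) d - indic (orient al rho T' d0) d) = 0.
  have := congr1 (fun B : divisor rho => B u) eb.
  by rewrite !(bernardi_orient maps sphere) // sumrB => /addIr->; rewrite subrr.
have [g gp gE] := flow_cobound maps sphere uT (antisym_orientation o1 o2) h0.
have o1' := orient_orientation maps' (unicellular_dual maps uT) d0.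
have o2' := orient_orientation maps' (unicellular_dual maps uT') d0.
have r' (S : {set D}) : unicellular al rho S ->
    forall v, conn_in al phi (orient al phi (~: S) d0) v (vtx phi d0).
  move=> uS v; apply: conn_sub (orient_reach maps' (unicellular_dual maps uS) d0 v) => d.
  by rewrite in_setI => /andP[].
have gE' y : g (val (vtx phi y)) = g y.
  by apply: (vtx_inv_eq gp); apply: val_inj; apply/eqP; apply: valP (vtx phi y).
have gc : forall u v : Vx phi, g (val u) = g (val v).
  apply: (laplacian_reach_const maps' o1' o2' (r' _ uT) (r' _ uT')) => v.
  rewrite laplacian_cobound; apply: eq_bigr => d _.
  have -> : cobound al (fun x => g (val (vtx phi x))) d = cobound al g d.
    by rewrite /cobound !gE'.
  rewrite -gE !(orient_dual _ _ maps) /indic !in_setC.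
  by case: (d \in _); case: (d \in _).
apply/setP => d; have := gE d.
rewrite /cobound -(gE' d) -(gE' (al d)) (gc _ (vtx phi d)) subrr /indic.
by case: (d \in _); case: (d \in _).
Qed.

End Trees.

(** [T'] and its divisor show that both uses of [epsilon] have a solution; [break_unique] and
    [bernardi_inj] show that it is the only one. *)
Lemma bernardi_act_eq d0 (T T' : {set D}) c :
  unicellular al rho T -> unicellular al rho T' ->
  torsor_rel d0 c T T' -> bernardi_act al rho d0 c T = T'.
Proof.
move=> uT uT' /(torsor_relP d0 uT uT')le.
have bE : break_act al rho c (bernardi al rho d0 T) = bernardi al rho d0 T'.
  rewrite /break_act; set P := fun B' => _; set B := epsilon _ _.
  have [brk [f fE]] : P B.
    apply: epsilon_spec; exists (bernardi al rho d0 T').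
    by split; first exact: bernardi_is_break.
  apply: break_unique => //; have [f' f'E] := le.
  exists (fun u => f u - f' u) => u.
  transitivity (laplacian al rho f u - laplacian al rho f' u); first by rewrite -fE -f'E; ring.
  by rewrite /laplacian -sumrB; apply: eq_bigr => d _; ring.
rewrite /bernardi_act bE; set P := fun S => _; set S := epsilon _ _.
have [/(spanning_tree_unicellular maps) uS e] : P S.
  by apply: epsilon_spec; exists T'; split=> //; apply: (unicellular_spanning_tree maps sphere).
exact: bernardi_inj e.
Qed.

Lemma torsor_rel_exists d0 (T : {set D}) c : unicellular al rho T ->
  exists2 T', unicellular al rho T' & torsor_rel d0 c T T'.
Proof.
move=> uT; have maps' := dual_maps_sym maps.
have con x y : conn_in al rho [set: D] x y.
  by apply: conn_sub (unicellular_conn maps uT x y) => d _; rewrite inE.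
have con' x y : conn_in al phi [set: D] x y.
  by apply: conn_sub (unicellular_conn maps' (unicellular_dual maps uT) x y) => d _; rewrite inE.
have [O1 o1 b1] := shiftable_chain maps sphere uT c (orient_orientation maps uT d0).
have [O2 [o2 b2 r r']] := equiv_orient_reach d0 maps con con' o1.
have [T' uT' e] := orientation_orient maps sphere uT o2 r r'.
exists T' => //; rewrite /torsor_rel e.
by apply: bicobound_ext (bicobound_add b2 b1) => d; ring.
Qed.

End Bernardi.

(** Passing to the dual reverses both orientations and changes the sign of [c d - c (al d)], so the
    whole chain is negated. *)
Lemma torsor_rel_dual (D : finType) (al rho phi : {perm D}) d0 c (T T' : {set D}) :
  dual_maps al rho phi -> torsor_rel al rho phi d0 c T T' ->
  torsor_rel al phi rho d0 (dual_chain al c) (~: T) (~: T').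
Proof.
move=> maps /bicobound_dual b.
apply: bicobound_ext (bicobound_sub (bicobound0 al phi rho) b) => d.
rewrite !(orient_dual _ _ maps) /indic /dual_chain !in_setC.
have [-> _ _] := maps.
by case: (d \in _); case: (d \in _) => /=; ring.
Qed.

(* Moving the base dart by rho changes the divisors of all trees by the same
   class; by duality so does phi, and the tour of T is made of such moves. *)
Lemma torsor_rel_base (D : finType) (al rho phi : {perm D}) d0 d1 c (T T' : {set D}) :
  dual_maps al rho phi -> spherical rho phi -> unicellular al rho T -> unicellular al rho T' ->
  torsor_rel al rho phi d0 c T T' -> torsor_rel al rho phi d1 c T T'.
Proof.
move=> maps sphere uT uT' b0; have maps' := dual_maps_sym maps.
have sphere' : spherical phi rho by rewrite /spherical addnC.
have [alK _ phiE] := maps.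
have phi_step d : torsor_rel al rho phi d c T T' -> torsor_rel al rho phi (phi d) c T T'.
  have cT := unicellular_dual maps uT; have cT' := unicellular_dual maps uT'.
  move=> /(torsor_rel_dual maps)/(torsor_rel_rot maps' sphere' cT cT').
  move=> /(torsor_rel_dual maps'); rewrite !setCK.
  by apply: bicobound_ext => d'; rewrite /dual_chain !alK.
rewrite -(iter_pos uT d0 d1); elim: (pos _ _ _ _ _) => //= n IHn.
rewrite {1}/tour_step; case: ifP => _; last exact: torsor_rel_rot.
by rewrite -phiE; apply: phi_step.
Qed.

Theorem theorem6p1 (D : finType) (alpha sigma : {perm D})
  (HG : ribbon_graph alpha sigma) (Hplanar : planar alpha sigma)
  (Hbridgeless : bridgeless alpha sigma)
  (d0 d0s : D) (c : D -> int) (T : {set D})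
  (HT : spanning_tree alpha sigma T) :
  ~: bernardi_act alpha sigma d0 c T
  = bernardi_act alpha (dual_rot alpha sigma) d0s (dual_chain alpha c) (~: T).
Proof.
have [alK al_neq _ _] := HG.
have maps : dual_maps alpha sigma (dual_rot alpha sigma).
  by split=> // d; rewrite permM.
have maps' := dual_maps_sym maps.
have sphere' : spherical (dual_rot alpha sigma) sigma by rewrite /spherical addnC.
have uT := spanning_tree_unicellular maps HT.
(* [T'] is the value of the action on [T]; its complement satisfies the dual relation, once the base
   is moved from [d0] to [d0s], and so is the value on the dual side. *)
have [T' uT' b] := torsor_rel_exists maps Hplanar d0 c uT.
rewrite (bernardi_act_eq maps Hplanar uT uT' b).
apply/esym/(bernardi_act_eq maps' sphere'); try exact: (unicellular_dual maps).
exact: (torsor_rel_dual maps (torsor_rel_base d0s maps Hplanar uT uT' b)).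
Qed.
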